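(* Every graph is the Hochster--Huneke graph of some complete equidimensional local ring.
   Context: Graphs are finite and simple, with at least two vertices. Local rings are Noetherian. For a $d$-dimensional local ring $A$ with minimal primes $\mathfrak{p}_1,\dots,\mathfrak{p}_s$, the Hochster--Huneke graph of $A$ has vertex set $\{1,\dots,s\}$, and $\{i,j\}$ (with $i\neq j$) is an edge if and only if $A/(\mathfrak{p}_i+\mathfrak{p}_j)$ has dimension $d-1$. The ring $A$ is equidimensional if $\dim A/\mathfrak{p}_i=d$ for all $i$. *)

(* Defs.v *)
From HB Require Import structures.
From mathcomp Require Import all_boot all_order all_algebra.
Set Implicit Arguments.
Unset Strict Implicit.
Unset Printing Implicit Defensive.
Import GRing.Theory.
Local Open Scope ring_scope.

(* Rings are commutative and nonzero.  [idealr A] is the library's type of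
   proper ideals and [prime_idealr A] its type of prime ideals, both as boolean
   predicates (classically, every proper ideal is of this form).  Equality of
   ideals as subsets of A is [=i], used instead of [=] throughout. *)

(* The unit ideal, which [idealr] excludes, is generated by 1. *)
Definition noetherian_ring (A : comNzRingType) : Prop :=
  forall I : idealr A, exists (n : nat) (g : 'I_n -> A),
    forall x : A, x \in I <-> exists c : 'I_n -> A, x = \sum_(i < n) c i * g i.

Definition maximal_ideal (A : comNzRingType) (M : idealr A) : Prop :=
  forall J : idealr A, {subset M <= J} -> J =i M.

Definition is_local_ring (A : comNzRingType) (m : idealr A) : Prop :=
  maximal_ideal m /\ forall M : idealr A, maximal_ideal M -> M =i m.

(* The coefficients c matter only for n = 0, where they give I ^ 0 = A. *)
Definition in_ideal_pow (A : comNzRingType) (I : idealr A) (n : nat) (x : A) :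
    Prop :=
  exists (k : nat) (c : 'I_k -> A) (y : 'I_k -> 'I_n -> A),
    (forall i j, y i j \in I) /\ x = \sum_(i < k) c i * \prod_(j < n) y i j.

Definition adic_cauchy (A : comNzRingType) (I : idealr A) (u : nat -> A) :
    Prop :=
  forall n : nat, exists N : nat, forall i j : nat,
    (N <= i)%N -> (N <= j)%N -> in_ideal_pow I n (u i - u j).

Definition adic_limit (A : comNzRingType) (I : idealr A) (u : nat -> A)
    (l : A) : Prop :=
  forall n : nat, exists N : nat, forall i : nat,
    (N <= i)%N -> in_ideal_pow I n (u i - l).

Definition adic_complete (A : comNzRingType) (I : idealr A) : Prop :=
  (forall x : A, (forall n : nat, in_ideal_pow I n x) -> x = 0) /\
  (forall u : nat -> A, adic_cauchy I u -> exists l : A, adic_limit I u l).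

(* Only p 0, ..., p n are constrained: p 0 < p 1 < ... < p n. *)
Definition prime_chain (R : comNzRingType) (n : nat)
    (p : nat -> prime_idealr R) : Prop :=
  forall i : nat, (i < n)%N ->
    {subset p i <= p i.+1} /\ ~ {subset p i.+1 <= p i}.

Definition has_krull_dim (R : comNzRingType) (d : nat) : Prop :=
  (exists p : nat -> prime_idealr R, prime_chain d p) /\
  (forall (n : nat) (p : nat -> prime_idealr R), prime_chain n p -> (n <= d)%N).

Definition minimal_prime (A : comNzRingType) (p : prime_idealr A) : Prop :=
  forall q : prime_idealr A, {subset q <= p} -> q =i p.

(* Here and below d stands for dim A. *)
Definition equidimensional (A : comNzRingType) (d : nat) : Prop :=
  forall p : prime_idealr A, minimal_prime p -> has_krull_dim {ideal_quot p} d.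

Definition minimal_primes_enum (A : comNzRingType) (s : nat)
    (p : 'I_s -> prime_idealr A) : Prop :=
  [/\ forall i, minimal_prime (p i),
      forall i j, p i =i p j -> i = j &
      forall q : prime_idealr A, minimal_prime q -> exists i, p i =i q].

(* If I + J is the unit ideal then no K qualifies: the zero ring has no
   dimension in nat. *)
Definition quot_sum_has_dim (A : comNzRingType) (I J : idealr A) (e : nat) :
    Prop :=
  exists K : idealr A,
    (forall x : A, x \in K <->
       exists a b : A, [/\ a \in I, b \in J & x = a + b]) /\
    has_krull_dim {ideal_quot K} e.

(* The condition e.+1 = d expresses e = d - 1 without truncated subtraction. *)
Definition hochster_huneke_edge (A : comNzRingType) (d s : nat)
    (p : 'I_s -> prime_idealr A) (i j : 'I_s) : Prop :=
  i <> j /\ exists e : nat, e.+1 = d /\ quot_sum_has_dim (p i) (p j) e.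

(* The Hochster-Huneke graph is defined up to the numbering of the minimal
   primes, hence up to isomorphism. *)
Definition is_hochster_huneke_graph (A : comNzRingType) (d : nat)
    (V : finType) (E : rel V) : Prop :=
  exists (s : nat) (p : 'I_s -> prime_idealr A) (f : V -> 'I_s),
    [/\ minimal_primes_enum p, bijective f &
        forall u v : V, E u v <-> hochster_huneke_edge d p (f u) (f v)].

(* Main.v *)
From HB Require Import structures.
Require Import Defs.
From mathcomp Require Import all_boot all_order all_algebra.
From mathcomp Require Import boolp ring.

(** Let P = F[[X, Y]].  Give each edge uv its own curve l_uv = Y - X^k, where
    k >= 1 depends on the edge, and glue copies of P indexed by the vertices:
    A is the ring of the families (a_v) of elements of P such that a_u - a_v
    lies in (l_uv) when uv is an edge, and in the maximal ideal otherwise.  As a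
    P-submodule of P^V containing the diagonal, A is finite over P, hence
    Noetherian and complete, and it is local.  A prime of A contains the kernel
    p_v of some projection, and A / p_v = P, so the p_v are the minimal primes
    and A is equidimensional of dimension 2.  Let t_v be the product of the
    curves of the edges at v and of one further curve l_vv.  The image of p_u in
    A / p_v = P contains t_u and t_v, which have a common factor only if uv is an
    edge; and then that image lies in (l_uv). *)

Set Implicit Arguments.
Unset Strict Implicit.
Unset Printing Implicit Defensive.
Import GRing.Theory.
Local Open Scope ring_scope.

(** * Formal power series *)

(** Geometrically, Spec A is a union of planes, one per vertex, two of which meet along a curve or
    only at the closed point. Dimension 2 is the least possible for this: in dimension 1 the closed
    point already has codimension 1, and a local ring would only give complete graphs. Gluing
    non-adjacent vertices at the closed point is what makes A local. The obstacle is the bound on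
    chains of primes. It rests on one fact about P: a prime strictly above a nonzero prime is the
    maximal ideal, which Weierstrass division and a vanishing determinant give directly. Hence P is
    built as F[[Y]][[X]], and the curves are chosen regular of order 1 in Y; they are prime,
    infinite in number over every field, and two of them meet only at the origin. Chains in A are
    moved to P by contraction along the diagonal, which loses nothing above a kernel p_v. Finiteness
    over P gives completeness for the powers of (X, Y)A only. The identity prod_v (a - a_v) = 0,
    polarised, puts the |V|-th power of the maximal ideal inside (X, Y)A, so the two topologies
    agree. *)

Record series (R : Type) := Series { coefs :> nat -> R }.

HB.instance Definition _ (R : Type) := gen_eqMixin (series R).
HB.instance Definition _ (R : Type) := gen_choiceMixin (series R).

Lemma seriesP (R : Type) (f g : series R) : (forall i, f i = g i) -> f = g.
Proof. by case: f g => [f] [g] /= /funext ->. Qed.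

Section SeriesRing.
Variable R : comNzRingType.
Implicit Types f g h : series R.

Definition series_zero : series R := Series (fun _ => 0).
Definition series_opp f : series R := Series (fun i => - f i).
Definition series_add f g : series R := Series (fun i => f i + g i).

Fact series_addA : associative series_add.
Proof. by move=> f g h; apply: seriesP => i /=; rewrite addrA. Qed.
Fact series_addC : commutative series_add.
Proof. by move=> f g; apply: seriesP => i /=; rewrite addrC. Qed.
Fact series_add0 : left_id series_zero series_add.
Proof. by move=> f; apply: seriesP => i /=; rewrite add0r. Qed.
Fact series_addN : left_inverse series_zero series_opp series_add.
Proof. by move=> f; apply: seriesP => i /=; rewrite addNr. Qed.

HB.instance Definition _ := GRing.isZmodule.Build (series R)
  series_addA series_addC series_add0 series_addN.

Definition mono (n : nat) (c : R) : series R :=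
  Series (fun i => if i == n then c else 0).

Definition series_mul f g : series R :=
  Series (fun n => \sum_(i < n.+1) f i * g (n - i)%N).

Definition truncate (N : nat) f : {poly R} := \poly_(i < N) f i.

(** Coefficient n of a product sees only the truncations at any N above n, so associativity and
    commutativity are inherited from polynomials. *)
Fact truncateM N f g n : (n < N)%N ->
  series_mul f g n = (truncate N f * truncate N g)`_n.
Proof.
move=> ltnN; rewrite coefM; apply: eq_bigr => i _.
rewrite !coef_poly (leq_ltn_trans (leq_ord i) ltnN).
by rewrite (leq_ltn_trans (leq_subr _ _) ltnN).
Qed.

Fact series_mulC : commutative series_mul.
Proof.
by move=> f g; apply: seriesP => n; rewrite !(truncateM _ _ (ltnSn n)) mulrC.
Qed.

Fact series_mulA : associative series_mul.
Proof.
move=> f g h; apply: seriesP => n; have tM := truncateM _ _ (ltnSn n).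
transitivity ((truncate n.+1 f * (truncate n.+1 g * truncate n.+1 h))`_n).
  rewrite coefM; apply: eq_bigr => i _; rewrite coef_poly ltn_ord.
  by rewrite -truncateM // ltnS leq_subr.
rewrite mulrA coefM; apply: eq_bigr => i _.
by rewrite -truncateM // coef_poly ltnS leq_subr.
Qed.

Fact series_mul1 : left_id (mono 0 1) series_mul.
Proof.
move=> f; apply: seriesP => n /=.
rewrite big_ord_recl /= mul1r subn0 big1 ?addr0 // => i _.
by rewrite mul0r.
Qed.

Fact series_mulDl : left_distributive series_mul +%R.
Proof.
move=> f g h; apply: seriesP => n /=; rewrite -big_split /=.
by apply: eq_bigr => i _; rewrite mulrDl.
Qed.

Fact series1_neq0 : mono 0 1 != 0.
Proof.
by apply/eqP => /(congr1 (fun f : series R => f 0%N)) /= /eqP; rewrite oner_eq0.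
Qed.

HB.instance Definition _ := GRing.Zmodule_isComNzRing.Build (series R)
  series_mulA series_mulC series_mul1 series_mulDl series1_neq0.

Lemma coef_series0 i : (0 : series R) i = 0. Proof. by []. Qed.
Lemma coef_seriesD f g i : (f + g) i = f i + g i. Proof. by []. Qed.
Lemma coef_seriesB f g i : (f - g) i = f i - g i. Proof. by []. Qed.
Lemma coef_seriesM f g n : (f * g) n = \sum_(i < n.+1) f i * g (n - i)%N.
Proof. by []. Qed.

Lemma coef_series_sum I (r : seq I) (Q : pred I) (F : I -> series R) i :
  (\sum_(j <- r | Q j) F j) i = \sum_(j <- r | Q j) F j i.
Proof. exact: (big_morph (fun f : series R => f i) (fun _ _ => erefl) erefl). Qed.

Lemma coef_monoM n c f i :
  (mono n c * f) i = if (n <= i)%N then c * f (i - n)%N else 0.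
Proof.
rewrite coef_seriesM; case: leqP => [le_ni|lt_in]; last first.
  rewrite big1 // => j _ /=; case: eqP => [e|]; last by rewrite mul0r.
  by move: (ltn_ord j); rewrite e ltnS leqNgt lt_in.
have ltni : (n < i.+1)%N by [].
rewrite (bigD1 (Ordinal ltni)) //= eqxx big1 ?addr0 // => j /eqP nej.
case: eqP => [e|]; last by rewrite mul0r.
by case: nej; apply: val_inj.
Qed.

Lemma mono_is_additive n : zmod_morphism (mono n).
Proof.
by move=> a b; apply: seriesP => i; rewrite /= ; case: eqP; rewrite ?subr0.
Qed.
HB.instance Definition _ n :=
  GRing.isZmodMorphism.Build R (series R) (mono n) (mono_is_additive n).

Lemma mono_is_multiplicative : monoid_morphism (mono 0).
Proof.
split=> // a b; apply: seriesP => i; rewrite coef_monoM /= subn0.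
by case: eqP; rewrite ?mulr0.
Qed.
HB.instance Definition _ :=
  GRing.isMonoidMorphism.Build R (series R) (mono 0) mono_is_multiplicative.

Lemma coef_series_mul0 f g : (f * g) 0%N = f 0%N * g 0%N.
Proof. by rewrite coef_seriesM big_ord1. Qed.

Definition shift (n : nat) f : series R := Series (fun i => f (n + i)%N).

Lemma series_decomp f : f = mono 0 (f 0%N) + mono 1 1 * shift 1 f.
Proof.
apply: seriesP => -[|i]; rewrite coef_seriesD coef_monoM /= ?addr0 //.
by rewrite add0r mul1r add1n subn1.
Qed.

Lemma series_order f : f != 0 ->
  exists n g, g 0%N != 0 /\ f = mono 1 1 ^+ n * g.
Proof.
move=> nzf; suff [n]: exists n, f n != 0.
  elim: n f {nzf} => [|n IH] f fn; first by exists 0%N, f; rewrite expr0 mul1r.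
  have [f0|nzf0] := eqVneq (f 0%N) 0; last by exists 0%N, f; rewrite expr0 mul1r.
  have [m [g [g0 fE]]] := IH (shift 1 f) fn.
  exists m.+1, g; split=> //; rewrite exprS -mulrA -fE.
  by rewrite {1}(series_decomp f) f0 raddf0 add0r.
apply: contrapT => f0; case/eqP: nzf; apply: seriesP => i.
by apply/eqP/negPn/negP => fi; apply: f0; exists i.
Qed.

Lemma coef_monoX n : mono 1 1 ^+ n = mono n 1.
Proof.
elim: n => [|n IH]; first by rewrite expr0.
rewrite exprS IH; apply: seriesP => -[|i]; rewrite coef_monoM //=.
by rewrite mul1r subn1.
Qed.

Lemma coef_order_mul0 n f g m :
  (forall i, (i < m)%N -> g i = 0) -> (n < m)%N -> (f * g) n = 0.
Proof.
move=> g0 nm; rewrite coef_seriesM big1 // => i _.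
by rewrite g0 ?mulr0 // (leq_ltn_trans (leq_subr _ _) nm).
Qed.

End SeriesRing.
Arguments mono {R}.

(** The choices [t] are returned along with the states [h]: in a division the states are the
    successive remainders, and the choices become the coefficients of the quotient. *)
Lemma dependent_choice_step (T H : Type) (I : nat -> H -> Prop)
    (step : nat -> H -> T -> H) (h0 : H) :
  I 0%N h0 -> (forall n h, I n h -> exists t, I n.+1 (step n h t)) ->
  exists (t : nat -> T) (h : nat -> H),
    [/\ h 0%N = h0, forall n, I n (h n) & forall n, h n.+1 = step n (h n) (t n)].
Proof.
(* [t0] is the default choice at states that violate the invariant. *)
move=> I0 IS; have [t0 _] := IS _ _ I0.
have /choice[F FP] : forall nh : nat * H, exists t,
    I nh.1 nh.2 -> I nh.1.+1 (step nh.1 nh.2 t).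
  move=> [n h] /=; have [/IS[t It]|nI] := pselect (I n h); first by exists t.
  by exists t0 => /nI.
pose h := fix h n := if n is m.+1 then step m (h m) (F (m, h m)) else h0.
exists (fun n => F (n, h n)), h; split=> //.
by elim=> //= n; apply: (FP (n, h n)).
Qed.

(** * Division of power series by successive approximation *)

Section Division.
Variable R : comNzRingType.

(* Inverses, Weierstrass division and the Hilbert basis argument are all
   instances, for different invariants [I n] of the n-th remainder. *)
Lemma series_division (r : nat) (f : 'I_r -> series R)
    (I : nat -> series R -> Prop) (h : series R) :
  I 0%N h ->
  (forall n h, I n h ->
     exists t : 'I_r -> R, I n.+1 (h - \sum_l mono n (t l) * f l)) ->
  exists c : 'I_r -> series R, forall n, exists h', I n h' /\
    forall i, (i < n)%N -> h' i = (h - \sum_l c l * f l) i.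
Proof.
move=> I0 IS.
have [t [u [u0 uI uS]]] := dependent_choice_step
  (step := fun n h t => h - \sum_l mono n (t l) * f l) I0 IS.
exists (fun l => Series (fun i => t i l)) => n; exists (u n); split=> // i ltin.
(* The n-th remainder involves the quotients truncated below degree n; the full quotients differ
   from these by series of order at least n, which leave coefficient i < n unchanged. *)
have -> : u n = h - \sum_l (\sum_(m < n) mono m (t m l)) * f l.
  elim: n {ltin} => [|n IH].
    by rewrite u0 big1 ?subr0 // => l _; rewrite big_ord0 mul0r.
  rewrite uS IH -addrA -opprD -big_split /=; congr (_ - _).
  by apply: eq_bigr => l _; rewrite big_ord_recr mulrDl.
rewrite !coef_seriesB !coef_series_sum; congr (_ - _); apply: eq_bigr => l _.
apply/eqP; rewrite -subr_eq0 -coef_seriesB -mulrBl mulrC; apply/eqP.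
apply: (coef_order_mul0 _ _ ltin) => j ltjn.
rewrite coef_seriesB coef_series_sum (bigD1 (Ordinal ltjn)) //= eqxx.
rewrite big1 ?addr0 ?subrr // => m /eqP nem; case: eqP => // e.
by case: nem; apply: val_inj.
Qed.

End Division.

Section SeriesUnit.
Variable R : comUnitRingType.
Implicit Types f g : series R.

Lemma series_inverse f : f 0%N \is a GRing.unit -> exists g, g * f = 1.
Proof.
move=> Uf.
pose I n (h : series R) := forall i, (i < n)%N -> h i = 0.
have [|n h hI|c cP] := @series_division R 1 (fun=> f) I 1; first by [].
  exists (fun=> h n / f 0%N) => i; rewrite ltnS leq_eqVlt big_ord1.
  rewrite coef_seriesB coef_monoM => /predU1P[->|ltin].
    by rewrite leqnn subnn mulrVK // subrr.
  by rewrite leqNgt ltin subr0 hI.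
exists (c 0); apply/esym/eqP; rewrite -subr_eq0; apply/eqP/seriesP => i.
have [h [hI /(_ _ (ltnSn i))]] := cP i.+1.
by rewrite big_ord1 hI.
Qed.

Definition series_unit : {pred series R} :=
  fun f => f 0%N \is a GRing.unit.

Definition series_inv f : series R :=
  match pselect (f 0%N \is a GRing.unit) with
  | left Uf => sval (cid (series_inverse Uf))
  | right _ => f
  end.

Fact series_mulVr : {in series_unit, left_inverse 1 series_inv *%R}.
Proof.
move=> f Uf; rewrite /series_inv; case: pselect => // Uf'.
by case: (cid _).
Qed.

Fact series_unitP f g : g * f = 1 -> series_unit f.
Proof.
move=> /(congr1 (fun h : series R => h 0%N)); rewrite coef_series_mul0.
by move=> gf; apply/unitrPr; exists (g 0%N); rewrite mulrC gf.
Qed.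

Fact series_inv_out : {in [predC series_unit], series_inv =1 id}.
Proof. by move=> f /negP nUf; rewrite /series_inv; case: pselect. Qed.

HB.instance Definition _ := GRing.ComNzRing_hasMulInverse.Build (series R)
  series_mulVr series_unitP series_inv_out.

Lemma unit_seriesE f : (f \is a GRing.unit) = (f 0%N \is a GRing.unit).
Proof. by []. Qed.

End SeriesUnit.

Section SeriesDomain.
Variable R : idomainType.

Fact series_integral (f g : series R) : f * g = 0 -> (f == 0) || (g == 0).
Proof.
move=> fg0; have [//|nzf] := eqVneq f 0; have [//|nzg] := eqVneq g 0.
move: fg0.
have [n [f' [f0 ->]]] := series_order nzf.
have [m [g' [g0 ->]]] := series_order nzg.
rewrite mulrACA -exprD coef_monoX.
move=> /(congr1 (fun h : series R => h (n + m)%N)); rewrite coef_monoM leqnn.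
rewrite subnn mul1r coef_series_mul0 => /eqP.
by rewrite mulf_eq0 (negPf f0) (negPf g0).
Qed.

HB.instance Definition _ :=
  GRing.ComUnitRing_isIntegral.Build (series R) series_integral.

End SeriesDomain.

Section MapSeries.
Variables (R R' : comNzRingType) (phi : {rmorphism R -> R'}).

Definition map_series (f : series R) : series R' := Series (fun i => phi (f i)).

Lemma map_series_is_additive : zmod_morphism map_series.
Proof. by move=> f g; apply: seriesP => i; rewrite /= rmorphB. Qed.
HB.instance Definition _ :=
  GRing.isZmodMorphism.Build _ _ map_series map_series_is_additive.

Lemma map_mono n c : map_series (mono n c) = mono n (phi c).
Proof. by apply: seriesP => i /=; case: eqP; rewrite ?rmorph0. Qed.

Lemma map_series_is_multiplicative : monoid_morphism map_series.
Proof.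
split=> [|f g]; first by rewrite -[1]/(mono 0 1) map_mono rmorph1.
apply: seriesP => n; rewrite /= rmorph_sum.
by apply: eq_bigr => i _; rewrite rmorphM.
Qed.
HB.instance Definition _ :=
  GRing.isMonoidMorphism.Build _ _ map_series map_series_is_multiplicative.

End MapSeries.

(** * Noetherian modules *)

Record submodule (R : pzRingType) (V : lmodType R) (N : V -> Prop) : Prop :=
  Submodule {
    submodule0 : N 0;
    submoduleD : forall x y, N x -> N y -> N (x + y);
    submoduleZ : forall c x, N x -> N (c *: x) }.

(** The intersection of the submodules containing [s]: bounding a span is then a mere application,
    and [spanP] recovers linear combinations. *)
Definition span (R : pzRingType) (V : lmodType R) (s : seq V) (x : V) : Prop :=
  forall M : V -> Prop, submodule M -> (forall y, y \in s -> M y) -> M x.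

Definition fin_gen (R : pzRingType) (V : lmodType R) (N : V -> Prop) : Prop :=
  exists s : seq V, (forall y, y \in s -> N y) /\ forall x, N x -> span s x.

Definition noetherian_module (R : pzRingType) (V : lmodType R) : Prop :=
  forall N : V -> Prop, submodule N -> fin_gen N.

Section Submodules.
Variables (R : pzRingType) (V : lmodType R).
Implicit Types (N : V -> Prop) (s : seq V).

Lemma submoduleB N x y : submodule N -> N x -> N y -> N (x - y).
Proof.
by move=> sN Nx Ny; rewrite -scaleN1r; apply: submoduleD => //; apply: submoduleZ.
Qed.

Lemma submodule_sum N I (r : seq I) (F : I -> V) :
  submodule N -> (forall i, N (F i)) -> N (\sum_(i <- r) F i).
Proof.
by move=> sN NF; apply: big_ind => //; [apply: submodule0 | apply: submoduleD].
Qed.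

Lemma span_submodule s : submodule (span s).
Proof.
split=> [M sM _|x y sx sy M sM Ms|c x sx M sM Ms].
- exact: submodule0.
- by apply: submoduleD; [|apply: sx|apply: sy].
- by apply: submoduleZ => //; apply: sx.
Qed.

Lemma mem_span s x : x \in s -> span s x.
Proof. by move=> xs M _; apply. Qed.

Lemma span_sub s N x : submodule N -> (forall y, y \in s -> N y) -> span s x -> N x.
Proof. by move=> sN Ns; apply. Qed.

Lemma span_mono s s' x : {subset s <= s'} -> span s x -> span s' x.
Proof. by move=> ss sx M sM Ms; apply: sx => // y /ss /Ms. Qed.

Lemma spanP s x : span s x ->
  exists c : 'I_(size s) -> R, x = \sum_i c i *: s`_i.
Proof.
move=> sx; apply: (sx (fun x => exists c : 'I_(size s) -> R, x = \sum_i c i *: s`_i)).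
  split.
- by exists (fun=> 0); rewrite big1 // => i _; rewrite scale0r.
- move=> _ _ [c ->] [d ->]; exists (fun i => c i + d i).
  by rewrite -big_split; apply: eq_bigr => i _; rewrite scalerDl.
- move=> a _ [c ->]; exists (fun i => a * c i).
  by rewrite scaler_sumr; apply: eq_bigr => i _; rewrite scalerA.
move=> y ys; have lt_y : (index y s < size s)%N by rewrite index_mem.
exists (fun i => (i == Ordinal lt_y)%:R).
rewrite (bigD1 (Ordinal lt_y)) //= eqxx scale1r nth_index // big1 ?addr0 // => i.
by move=> /negPf->; rewrite scale0r.
Qed.

(** Lifts generators along a relation, such as taking a lowest coefficient or a coordinate, without
    adding unrelated elements. *)
Lemma lift_seq (T : eqType) (s : seq V) (Q : T -> V -> Prop) :
  (forall y, y \in s -> exists x, Q x y) ->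
  exists t : seq T, (forall y, y \in s -> exists2 x, x \in t & Q x y) /\
    forall x, x \in t -> exists2 y, y \in s & Q x y.
Proof.
elim: s => [|y s IH] sQ; first by exists [::].
have [|t [t1 t2]] := IH; first by move=> z zs; apply: sQ; rewrite inE zs orbT.
have [x Qx] := sQ y (mem_head _ _); exists (x :: t); split=> z.
  rewrite inE => /predU1P[->|/t1[w wt Qw]]; first by exists x; rewrite ?mem_head.
  by exists w; rewrite // inE wt orbT.
rewrite inE => /predU1P[->|/t2[w wt Qw]]; first by exists y; rewrite ?mem_head.
by exists w; rewrite // inE wt orbT.
Qed.

End Submodules.

(** * The Hilbert basis theorem for power series *)

Section HilbertBasis.
Variable R : comNzRingType.
Hypothesis noethR : noetherian_module R^o.

Let S := series R.

Definition ord_ge (n : nat) (f : series R) : Prop :=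
  forall i, (i < n)%N -> f i = 0.

Lemma ord_ge_submodule n : submodule (V := S^o) (ord_ge n).
Proof.
split=> [//|f g fn gn i ltin|c f fn i ltin]; first by rewrite coef_seriesD fn ?gn ?addr0.
exact: coef_order_mul0 ltin.
Qed.

Lemma ord_ge_coef_mul n f g : ord_ge n f -> (g * f) n = g 0%N * f n.
Proof.
move=> fn; rewrite coef_seriesM big_ord_recl subn0 big1 ?addr0 // => i _.
by rewrite fn ?mulr0 // lift0 ltn_subrL (leq_ltn_trans _ (ltn_ord i)).
Qed.

Lemma ord_ge_next n f : ord_ge n f -> f n = 0 -> ord_ge n.+1 f.
Proof. by move=> fn f0 i; rewrite ltnS leq_eqVlt => /predU1P[->|/fn]. Qed.

Variables (N : S^o -> Prop) (sN : submodule N).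

(** Lowest coefficients play the part of the leading coefficients of the polynomial case. As [c] may
    be 0 this is an ideal, and multiplication by the variable makes it grow with [n]. *)
Let lead (n : nat) (c : R^o) : Prop :=
  exists f, [/\ N f, ord_ge n f & f n = c].

Lemma lead_submodule (M : S^o -> Prop) n : submodule M ->
  submodule (V := R^o) (fun c => exists f, [/\ M f, ord_ge n f & f n = c]).
Proof.
move=> sM; split.
- by exists 0; split=> //; apply: submodule0.
- move=> _ _ [f [Mf fn <-]] [g [Mg gn <-]]; exists (f + g); split=> //.
    exact: submoduleD.
  exact: (submoduleD (ord_ge_submodule n)).
- move=> c _ [f [Mf fn <-]]; exists (mono 0 c * f); split.
  + exact: (submoduleZ sM).
  + exact: (submoduleZ (ord_ge_submodule n)).
  + by rewrite ord_ge_coef_mul.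
Qed.

Lemma lead_le n m c : (n <= m)%N -> lead n c -> lead m c.
Proof.
move=> lenm [f [Nf fn <-]]; exists (mono (m - n)%N 1 * f); split.
- exact: (submoduleZ sN).
- move=> i ltim; rewrite coef_monoM; case: leqP => // le1.
  by rewrite fn ?mulr0 // ltn_subLR // subnK.
- by rewrite coef_monoM leq_subr subKn // mul1r.
Qed.

(** The increasing union of the ideals [lead n] is finitely generated, and each generator already
    appears at a finite stage. *)
Lemma lead_stable : exists a, forall n c, lead n c -> lead a c.
Proof.
have [|s [sl sg]] := noethR (N := fun c => exists n, lead n c).
  split.
  - by exists 0%N; apply: (submodule0 (lead_submodule 0 sN)).
  - move=> x y [n xn] [m ym]; exists (maxn n m).
    apply: (submoduleD (lead_submodule _ sN)).
      exact: lead_le (leq_maxl _ _) xn.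
    exact: lead_le (leq_maxr _ _) ym.
  - by move=> c x [n xn]; exists n; apply: (submoduleZ (lead_submodule _ sN)).
have [a sa] : exists a, forall c, c \in s -> lead a c.
  elim: s sl {sg} => [|y s IH] sl; first by exists 0%N.
  have [|a sa] := IH; first by move=> c cs; apply: sl; rewrite inE cs orbT.
  have [n yn] := sl y (mem_head _ _); exists (maxn n a) => c.
  rewrite inE => /predU1P[->|/sa ca]; first exact: lead_le (leq_maxl _ _) yn.
  exact: lead_le (leq_maxr _ _) ca.
exists a => n c nc; have /sg := ex_intro (fun n => lead n c) n nc.
by apply: span_sub sa; apply: lead_submodule.
Qed.

(* Dividing by these lifts raises the order of the remainder. *)
Lemma lead_lift n : exists t : seq S^o,
  (forall f, f \in t -> N f /\ ord_ge n f) /\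
  forall c, lead n c -> exists u : 'I_(size t) -> R, c = \sum_i u i * t`_i n.
Proof.
have [s [sl sg]] := noethR (lead_submodule n sN).
have [t [t1 t2]] := lift_seq (T := S^o)
  (V := R^o) (Q := fun f c => [/\ N f, ord_ge n f & f n = c]) sl.
exists t; split=> [f /t2[y _ [Nf fn _]] //|c /sg sc].
apply: (span_sub (N := fun c : R^o =>
  exists u : 'I_(size t) -> R, c = \sum_i u i * t`_i n) _ _ sc).
  split.
- by exists (fun=> 0); rewrite big1 // => i _; rewrite mul0r.
- move=> _ _ [u ->] [v ->]; exists (fun i => u i + v i).
  by rewrite -big_split; apply: eq_bigr => i _; rewrite mulrDl.
- move=> a _ [u ->]; exists (fun i => a * u i).
  by rewrite /GRing.scale /= mulr_sumr; apply: eq_bigr => i _; rewrite mulrA.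
move=> y /t1[f ft [_ _ <-]].
have lt_f : (index f t < size t)%N by rewrite index_mem.
exists (fun i => (i == Ordinal lt_f)%:R).
rewrite (bigD1 (Ordinal lt_f)) //= eqxx mul1r nth_index // big1 ?addr0 // => i.
by move=> /negPf->; rewrite mul0r.
Qed.

Lemma series_ideal_fin_gen : fin_gen N.
Proof.
have [a stab] := lead_stable.
have [t [tN tl]] := lead_lift a.
(* Below degree [a] finitely many corrections suffice, each with the lifts of its own degree. *)
have [s [sN' sg]] : exists s : seq S^o, (forall y, y \in s -> N y) /\
    forall f, N f -> exists f', [/\ span s f', N f' & ord_ge a (f - f')].
  elim: a {stab t tN tl} => [|n [s [s1 s2]]].
    exists [::]; split=> // f Nf; exists 0; split=> //.
      exact: (submodule0 (span_submodule _)).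
    exact: submodule0.
  have [t [tN tl]] := lead_lift n.
  exists (s ++ t); split=> [y|f Nf].
    by rewrite mem_cat => /orP[/s1|/tN[]].
  have [f' [sf' Nf' ff']] := s2 f Nf.
  have [|u uE] := tl ((f - f') n).
    by exists (f - f'); split=> //; apply: submoduleB.
  set g : S^o := \sum_i (mono 0 (u i) : S) *: t`_i.
  have tg : span t g.
    apply: (submodule_sum _ (span_submodule _)) => i.
    apply: (submoduleZ (span_submodule _)); apply: mem_span; exact: mem_nth.
  have Ng : N g by apply: span_sub sN _ tg => y /tN[].
  have gn : ord_ge n g by apply: span_sub (ord_ge_submodule n) _ tg => y /tN[].
  exists (f' + g); split.
  - apply: (submoduleD (span_submodule _)).
      by apply: span_mono sf' => y ys; rewrite mem_cat ys.
    by apply: span_mono tg => y yt; rewrite mem_cat yt orbT.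
  - exact: submoduleD.
  - rewrite opprD addrA; apply: ord_ge_next.
      exact: (submoduleB (ord_ge_submodule n)).
    rewrite coef_seriesB uE coef_series_sum; apply/eqP; rewrite subr_eq0; apply/eqP.
    apply: eq_bigr => i _.
    rewrite -[RHS]/((mono 0 (u i) * (t`_i : S)) n) ord_ge_coef_mul //.
    by have [] := tN t`_i (mem_nth _ (ltn_ord i)).
exists (s ++ t); split=> [y|f Nf].
  by rewrite mem_cat => /orP[/sN'|/tN[]].
have [f' [sf' Nf' ff']] := sg f Nf.
(* From order [a] on, stability lets the single list [t], multiplied by powers of the variable,
   clear every further coefficient, and the remainder tends to 0. *)
pose I n (h : S) := N h /\ ord_ge (n + a) h.
have [|n h [Nh hn]|c cP] :=
    @series_division R (size t) (fun i => t`_i) I (f - f').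
- by split; [apply: (submoduleB sN) | rewrite add0n].
- have [|u uE] := tl (h (n + a)%N); first by apply: (stab (n + a)%N); exists h.
  have tN' (i : 'I_(size t)) := tN t`_i (mem_nth _ (ltn_ord i)).
  exists u; split.
    apply: (submoduleB sN) => //; apply: (submodule_sum _ sN) => i.
    by apply: (submoduleZ sN); have [] := tN' i.
  have ge_n i : ord_ge (n + a) (mono n (u i) * t`_i).
    move=> j ltj; rewrite coef_monoM; case: leqP => // le1.
    by rewrite (proj2 (tN' i)) ?mulr0 // ltn_subLR.
  apply: ord_ge_next.
    apply: (submoduleB (ord_ge_submodule _)) => //.
    exact: (submodule_sum _ (ord_ge_submodule _)).
  rewrite coef_seriesB uE coef_series_sum; apply/eqP; rewrite subr_eq0; apply/eqP.
  by apply: eq_bigr => i _; rewrite coef_monoM leq_addr addKn.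
have fE : f = f' + \sum_i c i * t`_i.
  apply/eqP; rewrite addrC -subr_eq -subr_eq0; apply/eqP; apply: seriesP => i.
  have [h [[_ hi] /(_ _ (ltnSn i)) <-]] := cP i.+1.
  by rewrite hi // ltnS leq_addr.
rewrite fE; apply: (submoduleD (span_submodule _)).
  by apply: span_mono sf' => y ys; rewrite mem_cat ys.
apply: (submodule_sum _ (span_submodule _)) => i.
apply: (submoduleZ (span_submodule _)); apply: mem_span.
by rewrite mem_cat mem_nth ?orbT.
Qed.

End HilbertBasis.

Theorem series_noetherian (R : comNzRingType) :
  noetherian_module R^o -> noetherian_module (series R)^o.
Proof. by move=> noethR N sN; apply: series_ideal_fin_gen. Qed.

Lemma field_noetherian (F : fieldType) : noetherian_module F^o.
Proof.
move=> N sN; have [[c Nc nzc]|N0] := pselect (exists2 c, N c & c != 0).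
  exists [:: c]; split=> [y|x Nx]; first by rewrite inE => /eqP->.
  have -> : x = (x / c) *: c by rewrite /GRing.scale /= divfK.
  by apply: (submoduleZ (span_submodule _)); apply: mem_span; rewrite mem_head.
exists [::]; split=> // x Nx; suff -> : x = 0 by apply: (submodule0 (span_submodule _)).
by apply/eqP/negPn/negP => nzx; apply: N0; exists x.
Qed.

(* Peel off one coordinate at a time. *)
Lemma ffun_noetherian (R : comNzRingType) (V : finType) :
  noetherian_module R^o -> noetherian_module {ffun V -> R^o}.
Proof.
move=> noethR N sN.
suff H (s : seq V) (N' : {ffun V -> R^o} -> Prop) : submodule N' ->
    (forall x, N' x -> forall v, v \notin s -> x v = 0) -> fin_gen N'.
  by apply: (H (enum V)) => // x _ v; rewrite mem_enum.
elim: s N' => [|v s IH] N' sN' N'0.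
  exists [::]; split=> // x /N'0 x0.
  suff -> : x = 0 by apply: (submodule0 (span_submodule _)).
  by apply/ffunP => v; rewrite ffunE x0.
pose L (M : {ffun V -> R^o} -> Prop) (p : R^o) := exists2 x, M x & x v = p.
have sL M : submodule M -> submodule (L M).
  move=> sM; split.
  - by exists 0; rewrite ?ffunE //; apply: submodule0.
  - by move=> _ _ [x Mx <-] [y My <-]; exists (x + y); rewrite ?ffunE //; apply: submoduleD.
  - by move=> c _ [x Mx <-]; exists (c *: x); rewrite ?ffunE //; apply: submoduleZ.
have [l [lL lg]] := noethR _ (sL _ sN').
have [t [t1 t2]] := lift_seq (T := {ffun V -> R^o})
  (Q := fun x p => N' x /\ x v = p) (s := l)
  (fun p pl => let: ex_intro2 x Nx xp := lL p pl in ex_intro _ x (conj Nx xp)).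
have [||s' [s1 s2]] := IH (fun x => N' x /\ x v = 0).
- split.
  + by split; [apply: submodule0 | rewrite ffunE].
  + by move=> x y [Nx x0] [Ny y0]; split; [apply: submoduleD | rewrite ffunE x0 y0 addr0].
  + by move=> c x [Nx x0]; split; [apply: submoduleZ | rewrite ffunE x0 scaler0].
- move=> x [Nx x0] w ws; have [->//|nwv] := eqVneq w v.
  by apply: N'0 => //; rewrite inE negb_or nwv.
exists (t ++ s'); split=> [y|x Nx].
  by rewrite mem_cat => /orP[/t2[? _ []]|/s1[]].
have [y [Ny ty] yx] : L (fun y => N' y /\ span t y) (x v).
  apply: (@span_sub R R^o l); first apply: sL.
  - split.
    + by split; [apply: submodule0 | apply: (submodule0 (span_submodule _))].
    + by move=> ? ? [? ?] [? ?]; split; [|apply: (submoduleD (span_submodule _))];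
        try apply: submoduleD.
    + by move=> ? ? [? ?]; split; [|apply: (submoduleZ (span_submodule _))];
        try apply: submoduleZ.
  - by move=> p /t1[w wt [Nw wp]]; exists w => //; split=> //; apply: mem_span.
  - by apply: lg; exists x.
rewrite -(subrK y x); apply: (submoduleD (span_submodule _)).
  apply: span_mono (s2 _ _) => [z zs|]; first by rewrite mem_cat zs orbT.
  by split; [apply: submoduleB | rewrite !ffunE yx subrr].
by apply: span_mono ty => z zt; rewrite mem_cat zt.
Qed.

(** * The ring of power series in two variables *)

(** Ideals as propositions, the unit ideal allowed; [ex_idealr] and [ex_prime_idealr] pass to the
    boolean structures of the final statement. *)
Record is_ideal (R : comNzRingType) (J : R -> Prop) : Prop := IsIdeal {
  ideal_0 : J 0;
  ideal_D : forall x y, J x -> J y -> J (x + y);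
  ideal_M : forall a x, J x -> J (a * x) }.

Record is_prime (R : comNzRingType) (J : R -> Prop) : Prop := IsPrime {
  prime_ideal : is_ideal J;
  prime_proper : ~ J 1;
  prime_or : forall x y, J (x * y) -> J x \/ J y }.

Section IdealTheory.
Variables (R : comNzRingType) (J : R -> Prop).

Section Ideal.
Hypothesis iJ : is_ideal J.

Lemma ideal_Mr a x : J x -> J (x * a).
Proof. by rewrite mulrC; apply: ideal_M. Qed.

Lemma ideal_N x : J x -> J (- x).
Proof. by rewrite -mulN1r; apply: ideal_M. Qed.

Lemma ideal_B x y : J x -> J y -> J (x - y).
Proof. by move=> Jx Jy; apply: ideal_D => //; apply: ideal_N. Qed.

Lemma ideal_addl x y : J x -> J (x + y) -> J y.
Proof. by move=> Jx Jxy; rewrite -(addKr x y) addrC; apply: ideal_B. Qed.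

Lemma ideal_sum I (r : seq I) (F : I -> R) :
  (forall i, J (F i)) -> J (\sum_(i <- r) F i).
Proof.
by move=> JF; apply: big_ind => //; [apply: ideal_0 | apply: ideal_D].
Qed.

Lemma ideal_prod_congr I (r : seq I) (F G : I -> R) :
  (forall i, J (F i - G i)) -> J (\prod_(i <- r) F i - \prod_(i <- r) G i).
Proof.
move=> JFG; elim: r => [|i r IH]; first by rewrite !big_nil subrr; apply: ideal_0.
rewrite !big_cons.
have -> : F i * \prod_(j <- r) F j - G i * \prod_(j <- r) G j =
   (F i - G i) * \prod_(j <- r) F j +
   G i * (\prod_(j <- r) F j - \prod_(j <- r) G j).
  by rewrite mulrBl mulrBr addrA subrK.
by apply: (ideal_D iJ); [apply: ideal_Mr | apply: (ideal_M iJ)].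
Qed.

End Ideal.

Hypothesis pJ : is_prime J.
Let iJ := prime_ideal pJ.

Lemma prime_unit x y : x * y = 1 -> ~ J x.
Proof. by move=> xy Jx; apply: (prime_proper pJ); rewrite -xy; apply: (ideal_Mr iJ). Qed.

Lemma prime_exp x n : J (x ^+ n) -> J x.
Proof.
elim: n => [/(prime_proper pJ)//|n IH]; rewrite exprS => /(prime_or pJ)[//|].
exact: IH.
Qed.

Lemma prime_prod I (r : seq I) (Q : pred I) (F : I -> R) :
  J (\prod_(i <- r | Q i) F i) -> exists2 i, Q i & J (F i).
Proof.
elim: r => [|i r IH]; first by rewrite big_nil => /(prime_proper pJ).
rewrite big_cons; case: ifP => // Qi /(prime_or pJ)[Ji|/IH//].
by exists i.
Qed.

End IdealTheory.

Section TwoVariables.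
Variable F : fieldType.
Notation S := (series F).
Notation P := (series (series F)).

(** The outer variable is X and the inner one Y: [f i j] is the coefficient of X^i Y^j, and [f 0] is
    the restriction of f to X = 0. *)
Definition vY : P := mono 0 (mono 1 1).
Definition vX : P := mono 1 1.

Definition const_term (f : P) : F := f 0%N 0%N.

Lemma const_termD f g : const_term (f + g) = const_term f + const_term g.
Proof. by []. Qed.

Lemma const_termM f g : const_term (f * g) = const_term f * const_term g.
Proof. by rewrite /const_term !coef_series_mul0. Qed.

Lemma series2_unitE (f : P) : (f \is a GRing.unit) = (const_term f != 0).
Proof. by rewrite !unit_seriesE unitfE. Qed.

Lemma series1_factor (s : S) : s != 0 ->
  exists n u, u \is a GRing.unit /\ s = mono 1 1 ^+ n * u.
Proof.
move=> /series_order[n [u [u0 ->]]]; exists n, u.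
by rewrite unit_seriesE unitfE.
Qed.

Lemma max_ideal_gen (f : P) : const_term f = 0 ->
  f = vX * shift 1 f + vY * mono 0 (shift 1 (f 0%N)).
Proof.
move=> f0; rewrite {1}(series_decomp f) addrC; congr (_ + _).
rewrite [in LHS](series_decomp (f 0%N)) -/(const_term f) f0 raddf0 add0r.
exact: rmorphM.
Qed.

Lemma max_ideal_sub (J : P -> Prop) : is_ideal J -> J vX -> J vY ->
  forall f, const_term f = 0 -> J f.
Proof.
move=> iJ JX JY f /max_ideal_gen->.
by apply: ideal_D; rewrite // mulrC; apply: ideal_M.
Qed.

Lemma prime_sub_max (J : P -> Prop) f : is_prime J -> J f -> const_term f = 0.
Proof.
move=> pJ Jf; apply/eqP/negPn/negP => f0.
have Uf : f \is a GRing.unit by rewrite series2_unitE.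
exact: (prime_unit pJ (divrr Uf)).
Qed.

Lemma max_ideal_prime : is_prime (fun f : P => const_term f = 0).
Proof.
split; first split => [//|f g f0 g0|a f f0].
- by rewrite const_termD f0 g0 addr0.
- by rewrite const_termM f0 mulr0.
- by apply/eqP/oner_neq0.
by move=> f g /eqP; rewrite const_termM mulf_eq0 => /orP[]/eqP; [left|right].
Qed.

(* The series in X alone, inside F[[Y]][[X]]. *)
Definition iotaX : S -> P := map_series (mono 0).
HB.instance Definition _ := GRing.RMorphism.on iotaX.

Lemma iotaX_inj : injective iotaX.
Proof.
move=> s t st; apply: seriesP => i.
by have /(congr1 (fun f : P => f i 0%N)) := st.
Qed.

Lemma iotaX_var : iotaX (mono 1 1) = vX.
Proof. by rewrite /iotaX map_mono rmorph1. Qed.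

(** On X = 0, g is Y^n times a unit, so the coefficients in F[[Y]] can be reduced to degree below n
    in Y, one power of X at a time. Regrouped by powers of Y, the remainder has n coefficients in
    F[[X]]. *)
Lemma weierstrass (g : P) n u : u \is a GRing.unit -> g 0%N = mono 1 1 ^+ n * u ->
  forall f : P, exists (q : P) (r : 'I_n -> S),
    f = q * g + \sum_(j < n) vY ^+ j * iotaX (r j).
Proof.
move=> Uu g0 f.
pose I m (h : P) := forall i, (i < m)%N -> forall j, (n <= j)%N -> h i j = 0.
have [|m h hI|c cP] := @series_division _ 1 (fun=> g) I f; first by [].
  (* The part of [h m] from Y^n on is Y^n times [shift n (h m)], and the restriction of g is Y^n u,
     whence the quotient. *)
  exists (fun=> shift n (h m) / u) => i; rewrite ltnS leq_eqVlt big_ord1.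
  rewrite coef_seriesB coef_monoM => /predU1P[-> j lenj|ltim].
    rewrite leqnn subnn g0 mulrCA mulrVK // coef_seriesB coef_monoX coef_monoM.
    by rewrite lenj mul1r /= subnKC // subrr.
  by rewrite leqNgt ltim subr0; apply: hI.
exists (c 0), (fun j : 'I_n => Series (fun i => (f - c 0 * g) i j)).
apply/eqP; rewrite addrC -subr_eq; apply/eqP.
apply: seriesP => i; apply: seriesP => j.
rewrite coef_series_sum coef_series_sum.
have [h [hI /(_ _ (ltnSn i)) hE]] := cP i.+1; rewrite big_ord1 in hE.
move: (f - c 0 * g) hE => G hE.
have coefj (k : 'I_n) s : (vY ^+ k * iotaX s) i j = if j == k then s i else 0.
  rewrite /vY -rmorphXn coef_monoX coef_monoM leq0n subn0.
  rewrite coef_monoM /= mul1r; case: ltngtP => // [ltkj|->]; last by rewrite subnn.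
  by rewrite -[X in if X then _ else _]/(j - k == 0)%N subn_eq0 leqNgt ltkj.
under eq_bigr => k _ do rewrite coefj.
have [ltjn|lenj] := ltnP j n.
  rewrite (bigD1 (Ordinal ltjn)) //= eqxx big1 ?addr0 // => k /eqP nek.
  by case: eqP => // e; case: nek; apply: val_inj.
rewrite big1 => [|k _]; last by case: eqP => // e; move: (ltn_ord k); rewrite -e ltnNge lenj.
by rewrite -hE hI.
Qed.

(* Modulo a [g] that is regular in Y, n + 1 powers of h are linearly dependent
   over F[[X]]; the lowest coefficient of the relation is a power of X up to
   a unit, and lies in every prime containing g and h. *)
Lemma regular_prime_step (J1 J2 : P -> Prop) g h :
  is_prime J1 -> is_prime J2 -> (forall f, J1 f -> J2 f) ->
  J1 g -> g 0%N != 0 -> J2 h -> ~ J1 h -> J2 vX.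
Proof.
move=> p1 p2 J12 J1g nzg J2h J1h.
have [n [u [Uu g0]]] := series1_factor nzg.
have /choice[q /choice[r hE]] := fun i : nat => weierstrass Uu g0 (h ^+ i).
(* Row i holds the n remainder coefficients of h^i, padded by a zero column: the square matrix is
   singular, which gives a dependency over the domain F[[X]]. *)
pose M : 'M[S]_n.+1 := \matrix_(i, j) oapp (r i) 0 (insub (val j)).
have /eqP/det0P[v nzv vM] : \det M = 0.
  rewrite (expand_det_col _ ord_max) big1 // => i _.
  by rewrite mxE /= insubF ?mul0r //= ltnn.
have relJ : J1 (\sum_(i < n.+1) iotaX (v 0 i) * h ^+ i).
  under eq_bigr => i _ do rewrite hE mulrDr.
  rewrite big_split /=; apply: (ideal_D (prime_ideal p1)).
    apply: (ideal_sum (prime_ideal p1)) => i.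
    by do 2!apply: (ideal_M (prime_ideal p1)).
  under eq_bigr => i _ do rewrite mulr_sumr.
  rewrite exchange_big /=; apply: (ideal_sum (prime_ideal p1)) => j.
  under eq_bigr => i _ do rewrite mulrCA -rmorphM.
  rewrite -mulr_sumr -rmorph_sum.
  suff -> : \sum_(i < n.+1) v 0 i * r i j = 0.
    by rewrite rmorph0 mulr0; apply: (ideal_0 (prime_ideal p1)).
  have /matrixP/(_ 0 (widen_ord (leqnSn n) j)) := vM.
  rewrite !mxE => vMj; rewrite -[RHS]vMj; apply: eq_bigr => i _; rewrite mxE /=.
  by rewrite insubT //= => ltjn; congr (_ * r i _); apply: val_inj.
have [i [nzi lti]] : exists i : 'I_n.+1, v 0 i != 0 /\
    forall j : 'I_n.+1, (j < i)%N -> v 0 j = 0.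
  have [i0 nzi0] : exists i, v 0 i != 0.
    apply: contrapT => v0; case/eqP: nzv; apply/rowP => i; rewrite mxE.
    by apply/eqP/negPn/negP => vi; apply: v0; exists i.
  have [i nzi imin] := @arg_minnP _ i0 (fun i => v 0 i != 0) val nzi0.
  exists i; split=> // j; rewrite ltnNge => /negP ji.
  by apply/eqP/negPn/negP => /imin.
(* As h is not in J1, the factor h^i can be cancelled. Every term but the first is then a multiple
   of h, which lies in J2, so the coefficient [v 0 i] lies there too. *)
have : J1 (h ^+ i * \sum_(j < n.+1 | (i <= j)%N) iotaX (v 0 j) * h ^+ (j - i)).
  move: relJ; rewrite (bigID (fun j : 'I_n.+1 => i <= j)%N) /=.
  rewrite [X in _ + X]big1 ?addr0 => [|j]; last first.
    by rewrite -ltnNge => /lti->; rewrite rmorph0 mul0r.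
  rewrite mulr_sumr; congr J1; apply: eq_bigr => j leij.
  by rewrite mulrCA -exprD subnKC.
move=> /(prime_or p1)[/(prime_exp p1)//|/J12].
rewrite (bigD1 i) //= subnn expr0 mulr1 => J2s.
have : J2 (iotaX (v 0 i)).
  apply: (ideal_addl (prime_ideal p2) _ (eq_ind _ J2 J2s _ (addrC _ _))).
  apply: big_ind => [||j /andP[leij neji]].
  - exact: (ideal_0 (prime_ideal p2)).
  - exact: (ideal_D (prime_ideal p2)).
  apply: (ideal_M (prime_ideal p2)).
  have : (0 < j - i)%N by rewrite subn_gt0 ltn_neqAle leij eq_sym neji.
  by case: (j - i)%N => // k _; rewrite exprS; apply: (ideal_Mr (prime_ideal p2)).
have [a [w [Uw ->]]] := series1_factor nzi.
rewrite rmorphM rmorphXn /= iotaX_var => /(prime_or p2)[/(prime_exp p2)//|].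
have /(rmorph_unit iotaX) Uiw := Uw.
by move/(prime_unit p2 (divrr Uiw)).
Qed.

(** This carries the dimension theory of P. Up to a power of X, f is regular in Y: either X lies in
    J1, or [regular_prime_step] puts X in J2. Modulo X, an element of J2 that is nonzero on X = 0 is
    a power of Y times a unit, so Y lies in J2 as well. *)
Lemma prime_above_nonzero (J1 J2 : P -> Prop) f :
  is_prime J1 -> is_prime J2 -> (forall f, J1 f -> J2 f) ->
  ~ (forall f, J2 f -> J1 f) -> f != 0 -> J1 f ->
  forall h, const_term h = 0 -> J2 h.
Proof.
move=> p1 p2 J12 J21 nzf J1f.
have [h [J2h J1h]] : exists h, J2 h /\ ~ J1 h.
  apply: contrapT => nex; apply: J21 => h J2h; apply: contrapT => J1h.
  by apply: nex; exists h.
have axisY (g : P) : J2 vX -> J2 g -> g 0%N != 0 -> J2 vY.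
  move=> J2X J2g /series1_factor[n [u [Uu g0]]].
  have : J2 (mono 0 (g 0%N)).
    apply: (ideal_addl (prime_ideal p2) (ideal_Mr (prime_ideal p2) (shift 1 g) J2X)).
    by rewrite addrC -series_decomp.
  rewrite g0 rmorphM rmorphXn => /(prime_or p2)[/(prime_exp p2)//|].
  have /(rmorph_unit (mono 0)) Uiu := Uu.
  by move/(prime_unit p2 (divrr Uiu)).
have [a [g [nzg fE]]] := series_order nzf.
move: J1f; rewrite fE => /(prime_or p1)[/(prime_exp p1) J1X|J1g].
  apply: (max_ideal_sub (prime_ideal p2)); first exact: J12.
  apply: (axisY h) => //; first exact: J12.
  apply/eqP => h0; apply: J1h; rewrite (series_decomp h) h0 raddf0 add0r.
  exact: (ideal_Mr (prime_ideal p1)).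
have J2X : J2 vX by apply: regular_prime_step J1g nzg J2h J1h.
by apply: (max_ideal_sub (prime_ideal p2)) => //; apply: (axisY g) => //; apply: J12.
Qed.

(** The exponent starts at 1 so that every curve passes through the origin; on X = 0 each of them
    restricts to Y. *)
Definition curve (k : nat) : P := vY - vX ^+ k.+1.

Definition curve_ideal (k : nat) (f : P) : Prop := exists q, f = q * curve k.

Lemma curve_coef0 k : curve k 0%N = mono 1 1.
Proof. by rewrite /curve coef_seriesB /vX coef_monoX /= subr0. Qed.

Lemma curve_const k : const_term (curve k) = 0.
Proof. by rewrite /const_term curve_coef0. Qed.

Lemma curve_neq0 k : curve k != 0.
Proof.
apply/eqP => /(congr1 (fun f : P => f 0%N 1%N)); rewrite curve_coef0 /= => /eqP.
by rewrite oner_eq0.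
Qed.

Lemma curve_ideal_const k f : curve_ideal k f -> const_term f = 0.
Proof. by case=> q ->; rewrite const_termM curve_const mulr0. Qed.

(** If X^n is the lowest power of X in q, its coefficient times Y is the constant s_n, so that
    coefficient vanishes. Hence F[[X]] embeds in the quotient by the curve. *)
Lemma curve_ideal_iotaX k s : curve_ideal k (iotaX s) -> s = 0.
Proof.
case=> q sq; apply: iotaX_inj; rewrite rmorph0 sq.
have [->|/series_order[n [q' [nzq' qE]]]] := eqVneq q 0; first by rewrite mul0r.
case/eqP: nzq'; move: sq; rewrite qE -mulrA coef_monoX.
move=> /(congr1 (fun f : P => f n)).
rewrite coef_monoM leqnn subnn mul1r coef_series_mul0 curve_coef0 /=.
rewrite mulrC => sE; apply: seriesP => i; rewrite coef_series0.
have := congr1 (fun f : S => f i.+1) sE.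
by rewrite coef_monoM /= mul1r subn1.
Qed.

(** Division by a series of order 1 in Y leaves a remainder in F[[X]], so the quotient is the domain
    F[[X]]. *)
Lemma curve_prime k : is_prime (curve_ideal k).
Proof.
split; first split.
- by exists 0; rewrite mul0r.
- by move=> _ _ [p ->] [q ->]; exists (p + q); rewrite mulrDl.
- by move=> a _ [q ->]; exists (a * q); rewrite mulrA.
- by move=> /curve_ideal_const/eqP; apply/negP/oner_neq0.
have rem (f : P) : exists (q : P) (r : S), f = q * curve k + iotaX r.
  have [|q [r ->]] := weierstrass (n := 1) (unitr1 _) _ f (g := curve k).
    by rewrite curve_coef0 mulr1 expr1.
  by exists q, (r ord0); rewrite big_ord1 mul1r.
move=> f g [p fg]; have [q [r fE]] := rem f; have [q' [r' gE]] := rem g.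
have /curve_ideal_iotaX/eqP : curve_ideal k (iotaX (r * r')).
  exists (p - q * g - iotaX r * q').
  rewrite !mulrBl -fg fE gE rmorphM; ring.
rewrite mulf_eq0 => /orP[]/eqP r0; [left; exists q | right; exists q'].
  by rewrite fE r0 rmorph0 addr0.
by rewrite gE r0 rmorph0 addr0.
Qed.

Lemma curve_notX k : ~ curve_ideal k vX.
Proof.
rewrite -iotaX_var => /curve_ideal_iotaX /(congr1 (fun s : S => s 1%N)) /= /eqP.
by rewrite oner_eq0.
Qed.

(** The difference of two curves is a power of X times a unit, so J contains X, and then Y. *)
Lemma curves_coprime k l (J : P -> Prop) : k != l -> is_prime J ->
  J (curve k) -> J (curve l) -> forall f, const_term f = 0 -> J f.
Proof.
move=> nekl pJ; wlog ltkl : k l nekl / (k < l)%N => [W|].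
  case: (ltngtP k l) nekl => // lt _ Jk Jl.
    by apply: (W k l) => //; rewrite neq_ltn lt.
  by apply: (W l k) => //; rewrite neq_ltn lt.
move=> Jk Jl.
have JX : J vX.
  have : J (vX ^+ k.+1 * (1 - vX ^+ (l - k))).
    have -> : vX ^+ k.+1 * (1 - vX ^+ (l - k)) = curve l - curve k.
      rewrite mulrBr mulr1 -exprD addSn subnKC ?(ltnW ltkl) // /curve.
      ring.
    exact: (ideal_B (prime_ideal pJ)).
  move=> /(prime_or pJ)[/(prime_exp pJ)//|].
  have U : 1 - vX ^+ (l - k) \is a GRing.unit.
    rewrite series2_unitE /const_term coef_seriesB coef_monoX.
    have /negPf : (0 != l - k)%N by rewrite eq_sym subn_eq0 leqNgt ltkl.
    by rewrite /= => ->; rewrite subr0 oner_neq0.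
  by move/(prime_unit pJ (divrr U)).
apply: (max_ideal_sub (prime_ideal pJ)) => //.
have -> : vY = curve k + vX ^+ k * vX by rewrite -exprSr subrK.
by apply: (ideal_D (prime_ideal pJ)) => //; apply: (ideal_M (prime_ideal pJ)).
Qed.

End TwoVariables.

(** * Krull dimension by chains above an ideal *)

Section BooleanIdeals.
Variables (R : comNzRingType) (J : R -> Prop).

(** The hypotheses are arguments of the predicate so that the ideal structure can be attached to
    it. *)
Definition ideal_pred of is_ideal J & ~ J 1 : pred R := fun x => `[< J x >].

Section Proper.
Hypotheses (iJ : is_ideal J) (J1 : ~ J 1).

Fact ideal_pred_closed : idealr_closed (ideal_pred iJ J1).
Proof.
split=> [||a x y]; rewrite ?inE; first by apply/asboolP; apply: ideal_0.
  by apply/asboolP.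
move=> /asboolP Jx /asboolP Jy; apply/asboolP.
by apply: (ideal_D iJ) => //; apply: (ideal_M iJ).
Qed.
HB.instance Definition _ := isIdealr.Build R (ideal_pred iJ J1) ideal_pred_closed.

End Proper.

Lemma ex_idealr : is_ideal J -> ~ J 1 -> exists I : idealr R, forall x, x \in I <-> J x.
Proof.
by move=> iJ J1; exists (ideal_pred iJ J1) => x; split=> /asboolP.
Qed.

Definition prime_idealr_pred (pJ : is_prime J) : pred R :=
  ideal_pred (prime_ideal pJ) (prime_proper pJ).

Fact prime_idealr_pred_closed (pJ : is_prime J) :
  prime_idealr_closed (prime_idealr_pred pJ).
Proof.
by move=> x y /asboolP/(prime_or pJ)[]J'; apply/orP; [left|right]; apply/asboolP.
Qed.
HB.instance Definition _ pJ := Idealr.on (prime_idealr_pred pJ).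
HB.instance Definition _ pJ := isPrimeIdealrClosed.Build R (prime_idealr_pred pJ)
  (@prime_idealr_pred_closed pJ).

Lemma ex_prime_idealr : is_prime J ->
  exists I : prime_idealr R, forall x, x \in I <-> J x.
Proof.
by move=> pJ; exists (prime_idealr_pred pJ) => x; split=> /asboolP.
Qed.

End BooleanIdeals.

Lemma idealr_is_ideal (R : comNzRingType) (I : idealr R) :
  is_ideal (fun x => x \in I).
Proof. by split=> [|x y|a x]; [apply: rpred0 | apply: rpredD | apply: idealMr]. Qed.

Lemma prime_idealr_is_prime (R : comNzRingType) (I : prime_idealr R) :
  is_prime (fun x => x \in I).
Proof.
split; first exact: idealr_is_ideal.
  by rewrite idealr1.
by move=> x y; rewrite prime_idealrM => /orP.
Qed.

(** Chains of primes of R/J read in R, which spares the quotient rings. Every [p i] is prime, but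
    only those with i <= n are known to contain J. *)
Definition chain_above (R : comNzRingType) (J : R -> Prop) (n : nat)
    (p : nat -> R -> Prop) : Prop :=
  [/\ forall i, is_prime (p i), forall x, J x -> p 0%N x &
      forall i, (i < n)%N ->
        (forall x, p i x -> p i.+1 x) /\ ~ (forall x, p i.+1 x -> p i x)].

Definition dim_above (R : comNzRingType) (J : R -> Prop) (d : nat) : Prop :=
  (exists p, chain_above J d p) /\ forall n p, chain_above J n p -> (n <= d)%N.

Lemma chain_above_le (R : comNzRingType) (J : R -> Prop) n p i j x :
  chain_above J n p -> (i <= j)%N -> (j <= n)%N -> p i x -> p j x.
Proof.
move=> [_ _ pS]; elim: j => [|j IH]; first by rewrite leqn0 => /eqP->.
rewrite leq_eqVlt => /predU1P[->//|]; rewrite ltnS => leij ltjn pi.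
by apply: (proj1 (pS j ltjn)); apply: IH => //; apply: ltnW.
Qed.

(** Primes of B correspond to primes of A above the kernel: preimages bound the length of chains,
    and images provide one. *)
Lemma krull_dim_surjection (A B : comNzRingType) (phi : {rmorphism A -> B})
    (J : A -> Prop) d :
  (forall b, exists a, phi a = b) -> (forall a, phi a = 0 <-> J a) ->
  dim_above J d -> has_krull_dim B d.
Proof.
move=> surj ker [[p pd] dmax]; split; last first.
  move=> n q qc; apply: (dmax n (fun i a => phi a \in q i)).
  split=> [i|a /ker->|i /qc[sub nsub]]; last 2 first.
  - exact: rpred0.
  - split=> [x /sub//|nq]; apply: nsub => b; have [a <-] := surj b; exact: nq.
  split; first split => [|x y|a x].
  - by rewrite rmorph0 rpred0.
  - by rewrite rmorphD; apply: rpredD.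
  - by rewrite rmorphM; apply: idealMr.
  - by rewrite rmorph1 idealr1.
  - by move=> x y; rewrite rmorphM prime_idealrM => /orP.
(* The index is capped at d, since beyond it [p i] need not contain J and so need not descend to
   B. *)
have Jp i a : J a -> p (minn i d) a.
  case: (pd) => _ J0 _ /J0; exact: (chain_above_le pd (leq0n _) (geq_minr _ _)).
have lift i a a' : phi a = phi a' -> p (minn i d) a -> p (minn i d) a'.
  have pi : is_prime (p (minn i d)) by case: pd.
  move=> /eqP; rewrite -subr_eq0 -rmorphB => /eqP/ker/(Jp i) Ja pa.
  by rewrite -(subKr a a'); apply: (ideal_B (prime_ideal pi)).
have /choice[q qP] : forall i, exists q : prime_idealr B,
    forall a, phi a \in q <-> p (minn i d) a.
  move=> i; have pi : is_prime (p (minn i d)) by case: pd.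
  have [|q qP] := @ex_prime_idealr B (fun b => exists2 a, phi a = b & p (minn i d) a).
    split; first split.
    - by exists 0; rewrite ?rmorph0 //; apply: (ideal_0 (prime_ideal pi)).
    - move=> _ _ [a <- pa] [b <- pb]; exists (a + b); rewrite ?rmorphD //.
      exact: (ideal_D (prime_ideal pi)).
    - move=> c _ [a <- pa]; have [b <-] := surj c; exists (b * a); rewrite ?rmorphM //.
      exact: (ideal_M (prime_ideal pi)).
    - move=> [a]; rewrite -(rmorph1 phi) => /lift H /H; exact: (prime_proper pi).
    - move=> x y; have [a <-] := surj x; have [b <-] := surj y => -[c].
      rewrite -rmorphM => /lift H /H /(prime_or pi)[]; [left|right].
        by exists a.
      by exists b.
  exists q => a; rewrite qP; split=> [[a' /lift H /H //]|pa]; by exists a.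
exists q => i ltid; have [_ _ /(_ _ ltid)[sub nsub]] := pd.
have mi : minn i d = i by apply/minn_idPl/ltnW.
have mi1 : minn i.+1 d = i.+1 by apply/minn_idPl.
split=> [b|nq].
  by have [a <-] := surj b; move=> /qP; rewrite mi => /sub pa; apply/qP; rewrite mi1.
by apply: nsub => a pa; rewrite -mi; apply/qP/nq/qP; rewrite mi1.
Qed.

Lemma krull_dim_ideal_quot (A : comNzRingType) (K : idealr A) (J : A -> Prop) d :
  (forall x, x \in K <-> J x) -> dim_above J d -> has_krull_dim {ideal_quot K} d.
Proof.
pose phi : {rmorphism A -> {ideal_quot K}} := \pi_({ideal_quot K})%qT.
move=> KJ; apply: (krull_dim_surjection (phi := phi)).
  by move=> b; exists (repr b); apply: reprK.
move=> a; rewrite -KJ -{2}(subr0 a) Quotient.idealrBE.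
by rewrite -(rmorph0 phi); split=> /eqP.
Qed.

Lemma krull_dim_ring (A : comNzRingType) (J : A -> Prop) d :
  (forall x, J x <-> x = 0) -> dim_above J d -> has_krull_dim A d.
Proof.
move=> J0; apply: (krull_dim_surjection (phi := idfun)); first by move=> b; exists b.
by move=> a; rewrite J0.
Qed.

(** Serves to refute an edge, where the dimension of a quotient is a hypothesis. *)
Lemma quot_dim_chain (A : comNzRingType) (K : idealr A) d :
  has_krull_dim {ideal_quot K} d -> exists p, chain_above (fun x => x \in K) d p.
Proof.
move=> [[q qc] _]; pose phi : {rmorphism A -> {ideal_quot K}} := \pi_({ideal_quot K})%qT.
exists (fun i a => phi a \in q i).
split=> [i|a Ka|i /qc[sub nsub]].
- split; first split => [|x y|a x].
  + by rewrite rmorph0 rpred0.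
  + by rewrite rmorphD; apply: rpredD.
  + by rewrite rmorphM; apply: idealMr.
  + by rewrite rmorph1 idealr1.
  + by move=> x y; rewrite rmorphM prime_idealrM => /orP.
- suff -> : phi a = 0 by apply: rpred0.
  rewrite -(rmorph0 phi); apply/eqP.
  by rewrite -Quotient.idealrBE subr0.
- split=> [x /sub//|nq]; apply: nsub => b; rewrite -[b]reprK; exact: nq.
Qed.

(** * The glued ring *)

Lemma is_prime_preim (A B : comNzRingType) (phi : {rmorphism A -> B}) (J : B -> Prop) :
  is_prime J -> is_prime (fun a => J (phi a)).
Proof.
move=> pJ; split; first split => [|x y|a x].
- by rewrite rmorph0; apply: (ideal_0 (prime_ideal pJ)).
- by rewrite rmorphD; apply: (ideal_D (prime_ideal pJ)).
- by rewrite rmorphM; apply: (ideal_M (prime_ideal pJ)).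
- by rewrite rmorph1; apply: prime_proper.
- by move=> x y; rewrite rmorphM => /(prime_or pJ).
Qed.

Lemma is_prime0 (R : idomainType) : is_prime (fun x : R => x = 0).
Proof.
split; first split => [//|x y -> ->|a x ->]; rewrite ?addr0 ?mulr0 //.
  by apply/eqP/oner_neq0.
by move=> x y /eqP; rewrite mulf_eq0 => /orP[]/eqP; [left|right].
Qed.

Lemma chain_above_shift (R : comNzRingType) (J : R -> Prop) n p :
  chain_above J n.+1 p -> chain_above (p 1%N) n (fun i => p i.+1).
Proof. by case=> pp _ pS; split=> // i ltin; apply: pS. Qed.

(** * Chains of primes in F[[X, Y]] *)

Section TwoVariableChains.
Variable F : fieldType.
Implicit Types (J : series (series F) -> Prop) (p : nat -> series (series F) -> Prop).

Lemma chain_above_max J n p :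
  (forall f, const_term f = 0 -> J f) -> chain_above J n p -> n = 0%N.
Proof.
move=> mJ; case: n => // n [pp J0 /(_ 0%N isT)[_ []]] f /(prime_sub_max (pp 1%N)).
by move=> /mJ/J0.
Qed.

(** If there is a first step, the second prime lies strictly above a prime containing f, so it
    contains the maximal ideal and nothing follows. *)
Lemma chain_above_nonzero J n p f :
  f != 0 -> J f -> chain_above J n p -> (n <= 1)%N.
Proof.
move=> nzf Jf; case: n => // n cp; have [pp J0 /(_ 0%N isT)[sub nsub]] := cp.
rewrite (chain_above_max _ (chain_above_shift cp)) // => h h0.
exact: (prime_above_nonzero (pp 0%N) (pp 1%N) sub nsub nzf (J0 _ Jf)).
Qed.

(** The second prime is nonzero, so at most one step follows it. *)
Lemma chain_above_le2 J n p : chain_above J n p -> (n <= 2)%N.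
Proof.
case: n => // n cp; have [pp J0 /(_ 0%N isT)[sub nsub]] := cp.
have [f [p1f p0f]] : exists f, p 1%N f /\ ~ p 0%N f.
  apply: contrapT => nex; apply: nsub => h p1h; apply: contrapT => p0h.
  by apply: nex; exists h.
apply: (chain_above_nonzero (f := f) _ p1f (chain_above_shift cp)).
by apply/eqP => f0; apply: p0f; rewrite f0; apply: (ideal_0 (prime_ideal (pp 0%N))).
Qed.

End TwoVariableChains.

Section GluedRing.
Variables (F : fieldType) (V : finType) (E : rel V).
Notation P := (series (series F)).

(** Coding the unordered pair makes the curve symmetric in u and v; the singletons, which code the
    extra curves l_vv, differ from all codes of pairs of distinct vertices. *)
Definition edge_code (u v : V) : nat := enum_rank [set u; v].
Definition edge_curve (u v : V) : P := curve F (edge_code u v).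

Definition glue_ideal (u v : V) (f : P) : Prop :=
  if E u v then curve_ideal (edge_code u v) f else const_term f = 0.

Definition glued : pred {ffun V -> P^o} :=
  fun a => `[< forall u v, glue_ideal u v (a u - a v : P) >].

Lemma glue_idealP u v : is_ideal (glue_ideal u v).
Proof.
rewrite /glue_ideal; case: (E u v).
  exact: (prime_ideal (curve_prime _ _)).
exact: (prime_ideal (max_ideal_prime F)).
Qed.

Fact glued_subring_closed : subring_closed glued.
Proof.
split=> [|a b /asboolP ga /asboolP gb|a b /asboolP ga /asboolP gb];
  apply/asboolP => u v; rewrite !ffunE.
- by rewrite subrr; apply: (ideal_0 (glue_idealP u v)).
- have -> : (a u - b u) - (a v - b v) = (a u - a v) - (b u - b v).
    by rewrite opprD addrACA -opprD.
  exact: (ideal_B (glue_idealP u v)).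
- have -> : a u * b u - a v * b v = (a u : P) * (b u - b v : P) + (a u - a v : P) * (b v : P).
    by rewrite mulrBr mulrBl addrA subrK.
  by apply: (ideal_D (glue_idealP u v));
     [apply: (ideal_M (glue_idealP u v)) | apply: (ideal_Mr (glue_idealP u v))].
Qed.

(* The vertex only witnesses that the product is not the zero ring. *)
Record glued_ring (v0 : V) : Type :=
  Glued { glued_val : {ffun V -> P^o}; glued_valP : glued glued_val }.

Section Instances.
Variable v0 : V.
HB.instance Definition _ := [isSub for @glued_val v0].
HB.instance Definition _ := [Choice of glued_ring v0 by <:].
HB.instance Definition _ :=
  GRing.SubChoice_isSubPzRing.Build _ glued (glued_ring v0) glued_subring_closed.

Fact glued_mulC : commutative (@GRing.mul (glued_ring v0)).
Proof. by move=> a b; apply: val_inj; apply/ffunP => v; rewrite !ffunE mulrC. Qed.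
HB.instance Definition _ := GRing.PzRing_hasCommutativeMul.Build (glued_ring v0) glued_mulC.

Fact glued_1_neq0 : 1 != 0 :> glued_ring v0.
Proof.
apply/eqP => /(congr1 (fun a => glued_val a v0)); rewrite !ffunE => /eqP.
by rewrite oner_eq0.
Qed.
HB.instance Definition _ := GRing.PzSemiRing_isNonZero.Build (glued_ring v0) glued_1_neq0.
End Instances.

Hypothesis E_sym : symmetric E.
Variable v0 : V.
Notation A := (glued_ring v0).

Definition ev (v : V) (a : A) : P := glued_val a v.

Lemma ev_is_zmod_morphism v : zmod_morphism (ev v).
Proof. by move=> a b; rewrite /ev /= !ffunE. Qed.
HB.instance Definition _ v := GRing.isZmodMorphism.Build A P (ev v) (ev_is_zmod_morphism v).

Lemma ev_is_monoid_morphism v : monoid_morphism (ev v).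
Proof. by split=> [|a b]; rewrite /ev /= !ffunE. Qed.
HB.instance Definition _ v := GRing.isMonoidMorphism.Build A P (ev v) (ev_is_monoid_morphism v).

Arguments ev : simpl never.

Lemma ev0 v : ev v 0 = 0. Proof. exact: rmorph0. Qed.
Lemma ev1 v : ev v 1 = 1. Proof. exact: rmorph1. Qed.
Lemma evD v : {morph ev v : a b / a + b}. Proof. exact: rmorphD. Qed.
Lemma evB v : {morph ev v : a b / a - b}. Proof. exact: rmorphB. Qed.
Lemma evM v : {morph ev v : a b / a * b}. Proof. exact: rmorphM. Qed.
Definition evE := (ev0, ev1, evD, evB, evM).

Lemma ev_inj a b : (forall v, ev v a = ev v b) -> a = b.
Proof. by move=> ab; apply: val_inj; apply/ffunP. Qed.

Lemma ev_glue u v a : glue_ideal u v (ev u a - ev v a).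
Proof. by have /asboolP := glued_valP a. Qed.

Lemma ex_glued (a : V -> P) : (forall u v, glue_ideal u v (a u - a v)) ->
  exists b : A, forall v, ev v b = a v.
Proof.
move=> ga; have gb : glued [ffun v => a v].
  by apply/asboolP => u v; rewrite !ffunE.
by exists (Glued v0 gb) => v; rewrite /ev /= ffunE.
Qed.

Fact diag_subproof (f : P) : glued [ffun=> f].
Proof.
by apply/asboolP => u v; rewrite !ffunE subrr; apply: (ideal_0 (glue_idealP u v)).
Qed.
Definition diag (f : P) : A := Glued v0 (diag_subproof f).

Lemma ev_diag v f : ev v (diag f) = f.
Proof. by rewrite /ev /= ffunE. Qed.

Lemma diag_is_zmod_morphism : zmod_morphism diag.
Proof. by move=> f g; apply: ev_inj => v; rewrite evB !ev_diag. Qed.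
HB.instance Definition _ := GRing.isZmodMorphism.Build P A diag diag_is_zmod_morphism.

Lemma diag_is_monoid_morphism : monoid_morphism diag.
Proof.
by split=> [|f g]; apply: ev_inj => v; rewrite ?evE !ev_diag.
Qed.
HB.instance Definition _ := GRing.isMonoidMorphism.Build P A diag diag_is_monoid_morphism.

Lemma edge_codeC u v : edge_code u v = edge_code v u.
Proof. by rewrite /edge_code setUC. Qed.

Lemma glue_idealC u v f : glue_ideal u v f -> glue_ideal v u f.
Proof. by rewrite /glue_ideal E_sym edge_codeC. Qed.

Lemma glue_ideal_const u v f : glue_ideal u v f -> const_term f = 0.
Proof. by rewrite /glue_ideal; case: ifP => // _; apply: curve_ideal_const. Qed.

Lemma const_term_ev u v a : const_term (ev u a) = const_term (ev v a).
Proof.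
apply/eqP; rewrite -subr_eq0; apply/eqP.
exact: glue_ideal_const (ev_glue u v a).
Qed.

Definition glued_max (a : A) : Prop := forall v, const_term (ev v a) = 0.

Lemma glued_maxP v a : glued_max a <-> const_term (ev v a) = 0.
Proof. by split=> [//|a0 u]; rewrite (const_term_ev u v). Qed.

Lemma glued_max_prime : is_prime glued_max.
Proof.
have -> : glued_max = fun a => const_term (ev v0 a) = 0.
  by apply/funext => a; apply/propext; apply: glued_maxP.
exact: (is_prime_preim (ev v0) (max_ideal_prime F)).
Qed.

(** Inverting each coordinate stays in A, because 1/x - 1/y is a multiple of x - y. *)
Lemma glued_unit a : ~ glued_max a -> exists b, a * b = 1.
Proof.
move=> na; have Ua v : ev v a \is a GRing.unit.
  by rewrite series2_unitE; apply/eqP => /glued_maxP.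
have [u v|b bE] := @ex_glued (fun v => (ev v a)^-1).
  have -> : (ev u a)^-1 - (ev v a)^-1 = - ((ev u a)^-1 * (ev v a)^-1) * (ev u a - ev v a).
    by rewrite mulNr mulrBr opprB divrK // mulrAC mulVr // mul1r.
  by apply: (ideal_M (glue_idealP u v)); apply: ev_glue.
by exists b; apply: ev_inj => v; rewrite evE bE ev1 divrr.
Qed.

(* The factor [u = v] makes the product lie in the maximal ideal when v is isolated. *)
Definition vertex_curve (v : V) : P :=
  \prod_(u | E v u || (u == v)) edge_curve u v.

Lemma vertex_curve_neq0 v : vertex_curve v != 0.
Proof. by apply/prodf_neq0 => u _; apply: curve_neq0. Qed.

Lemma vertex_curve_glue u v : glue_ideal u v (vertex_curve v).
Proof.
rewrite /glue_ideal; case: ifP => Euv.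
  rewrite /vertex_curve (bigD1 u) /=; last by rewrite E_sym Euv.
  by rewrite mulrC; set q := (X in X * _); exists q.
rewrite /vertex_curve (bigD1 v) /=; last by rewrite eqxx orbT.
by rewrite const_termM curve_const mul0r.
Qed.

(** A family supported at v only has to meet the gluing conditions at v, and t_v lies in all of
    their ideals. These elements separate the kernels. *)
Lemma ex_vertex_bump v : exists b : A,
  forall w, ev w b = if w == v then vertex_curve v else 0.
Proof.
apply: ex_glued => u w.
have [->|_] := eqVneq u v; have [->|_] := eqVneq w v; rewrite ?subrr.
- exact: (ideal_0 (glue_idealP _ _)).
- by rewrite subr0; apply: glue_idealC; apply: vertex_curve_glue.
- by rewrite sub0r; apply: (ideal_N (glue_idealP _ _)); apply: vertex_curve_glue.
- exact: (ideal_0 (glue_idealP _ _)).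
Qed.

Lemma kernel_prime v : is_prime (fun a : A => ev v a = 0).
Proof. exact: (is_prime_preim (ev v) (is_prime0 P)). Qed.

Lemma kernel_incomparable u v :
  (forall a : A, ev u a = 0 -> ev v a = 0) -> u = v.
Proof.
move=> uv; have [b bE] := ex_vertex_bump v; apply/eqP/negPn/negP => neuv.
have := uv b; rewrite !bE eqxx (negPf neuv) => /(_ erefl)/eqP.
by rewrite (negPf (vertex_curve_neq0 v)).
Qed.

(** A product of one element from each kernel vanishes in every coordinate, so J contains one of the
    factors. *)
Lemma prime_contains_kernel (J : A -> Prop) : is_prime J ->
  exists v, forall a, ev v a = 0 -> J a.
Proof.
move=> pJ; apply: contrapT => nex.
have /choice[b bP] : forall v, exists a, ev v a = 0 /\ ~ J a.
  move=> v; apply: contrapT => nb; apply: nex; exists v => a a0.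
  by apply: contrapT => Ja; apply: nb; exists a.
have : J (\prod_v b v).
  have -> : \prod_v b v = 0; last exact: (ideal_0 (prime_ideal pJ)).
  apply: ev_inj => v; rewrite rmorph_prod ev0 (bigD1 v) //=.
  by rewrite (proj1 (bP v)) mul0r.
by case/(prime_prod pJ) => v _; apply: (proj2 (bP v)).
Qed.

(** Modulo the kernel at v, a equals the constant family on [ev v a]. A prime above that kernel is
    thus determined by its contraction along [diag], and strict inclusions stay strict. *)
Lemma contract_kernel (J : A -> Prop) v a : is_prime J ->
  (forall a, ev v a = 0 -> J a) -> J a <-> J (diag (ev v a)).
Proof.
move=> pJ kJ; have Jd : J (a - diag (ev v a)).
  by apply: kJ; rewrite evB ev_diag subrr.
split=> Ja; last by rewrite -(subrK (diag (ev v a)) a); apply: (ideal_D (prime_ideal pJ)).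
by rewrite -(subKr a (diag _)); apply: (ideal_B (prime_ideal pJ)).
Qed.

Lemma contract_chain (J : A -> Prop) n p v : chain_above J n p ->
  (forall a, ev v a = 0 -> p 0%N a) ->
  chain_above (fun f => p 0%N (diag f)) n (fun i f => p i (diag f)).
Proof.
move=> cp k0; have [pp J0 pS] := cp.
have ki i : (i <= n)%N -> forall a, ev v a = 0 -> p i a.
  by move=> lein a /k0; apply: chain_above_le cp _ _.
split=> [i|//|i ltin]; first exact: is_prime_preim.
have [sub nsub] := pS i ltin; split=> [f|nd]; first exact: sub.
apply: nsub => a /(contract_kernel _ (pp _) (ki _ ltin)) /nd.
by rewrite -(contract_kernel _ (pp _) (ki _ (ltnW ltin))).
Qed.

Lemma glued_chain_le2 (J : A -> Prop) n p : chain_above J n p -> (n <= 2)%N.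
Proof.
move=> cp; have [pp _ _] := cp; have [v kv] := prime_contains_kernel (pp 0%N).
exact: chain_above_le2 (contract_chain cp kv).
Qed.

Lemma kernel_dim v : dim_above (fun a : A => ev v a = 0) 2.
Proof.
split; last exact: glued_chain_le2.
(* The pullback along [ev v] of the flag 0 < (l_vv) < (X, Y). *)
exists (fun i a => match i with 0%N => ev v a = 0
  | 1%N => curve_ideal (edge_code v v) (ev v a) | _ => const_term (ev v a) = 0 end).
split=> // [[|[|i]]|[|[|i]]] //; last 2 first.
- move=> _; split=> [a ->|sub]; first exact: (ideal_0 (prime_ideal (curve_prime _ _))).
  have : ev v (diag (edge_curve v v)) = 0.
    by apply: sub; rewrite ev_diag; exists 1; rewrite mul1r.
  by rewrite ev_diag => /eqP; rewrite (negPf (curve_neq0 _ _)).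
- move=> _; split=> [a /curve_ideal_const//|sub].
  by have := sub (diag (vX F)); rewrite ev_diag => /(_ erefl)/curve_notX.
- exact: kernel_prime.
- exact: (is_prime_preim (ev v) (curve_prime _ _)).
- exact: (is_prime_preim (ev v) (max_ideal_prime F)).
Qed.

Lemma glued_dim : dim_above (fun a : A => a = 0) 2.
Proof.
split; last exact: glued_chain_le2.
have [[p [pp J0 pS]] _] := kernel_dim v0; exists p; split=> // a ->.
by apply: J0; rewrite ev0.
Qed.

(** * Sums of two minimal primes *)

Definition kernel_sum (u v : V) (a : A) : Prop :=
  exists x y : A, [/\ ev u x = 0, ev v y = 0 & a = x + y].

Lemma kernel_suml u v a : ev u a = 0 -> kernel_sum u v a.
Proof. by exists a, 0; rewrite ev0 addr0. Qed.

Lemma kernel_sumr u v a : ev v a = 0 -> kernel_sum u v a.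
Proof. by exists 0, a; rewrite ev0 add0r. Qed.

Lemma kernel_sum_ideal u v : is_ideal (kernel_sum u v).
Proof.
split=> [|_ _ [x [y [x0 y0 ->]]] [z [t [z0 t0 ->]]]|a _ [x [y [x0 y0 ->]]]].
- by apply: kernel_suml; rewrite ev0.
- by exists (x + z), (y + t); rewrite !evD x0 y0 z0 t0 !addr0 addrACA.
- by exists (a * x), (a * y); rewrite !evM x0 y0 !mulr0 mulrDr.
Qed.

(** The part that vanishes at u takes at v a value constrained by the gluing condition itself, and
    the other part vanishes at v. *)
Lemma kernel_sum_glue u v a : kernel_sum u v a -> glue_ideal u v (ev v a).
Proof.
case=> x [y [x0 y0 ->]]; rewrite evD y0 addr0; apply: glue_idealC.
by have := ev_glue v u x; rewrite x0 subr0.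
Qed.

Lemma kernel_sum_proper u v : ~ kernel_sum u v 1.
Proof.
move=> /kernel_sum_glue/glue_ideal_const/eqP.
by rewrite ev1; apply/negP/oner_neq0.
Qed.

(** The family supported at v with value t_v vanishes at u, and its difference with the constant
    family t_v vanishes at v. *)
Lemma kernel_sum_vertex_curve u v : u != v -> kernel_sum u v (diag (vertex_curve v)).
Proof.
move=> neuv; have [b bE] := ex_vertex_bump v.
exists b, (diag (vertex_curve v) - b); rewrite evB ev_diag !bE eqxx (negPf neuv).
by rewrite subrr addrC subrK.
Qed.

Lemma kernel_sumC u v a : kernel_sum u v a -> kernel_sum v u a.
Proof. by case=> x [y [x0 y0 ->]]; exists y, x; rewrite addrC. Qed.

Lemma kernel_sum_dim u v : E u v -> u != v -> dim_above (kernel_sum u v) 1.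
Proof.
move=> Euv neuv; split.
  exists (fun i a => match i with 0%N => curve_ideal (edge_code u v) (ev v a)
    | _ => const_term (ev v a) = 0 end); split=> [[|i]|a|[|i] // _].
  - exact: (is_prime_preim (ev v) (curve_prime _ _)).
  - exact: (is_prime_preim (ev v) (max_ideal_prime F)).
  - by move=> /kernel_sum_glue; rewrite /glue_ideal Euv.
  - split=> [a /curve_ideal_const//|sub].
    by have := sub (diag (vX F)); rewrite ev_diag => /(_ erefl)/curve_notX.
(* For the upper bound, the chain contracts to P, where its first prime contains the nonzero t_v. *)
move=> n p cp; have [_ J0 _] := cp.
have kv a : ev v a = 0 -> p 0%N a by move/(kernel_sumr u)/J0.
apply: (chain_above_nonzero (vertex_curve_neq0 v) _ (contract_chain cp kv)).
by apply: J0; apply: kernel_sum_vertex_curve.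
Qed.

Lemma edge_code_inj a b u v : edge_code a u = edge_code b v ->
  u != v -> a = v /\ b = u.
Proof.
move=> /ord_inj/enum_rank_inj/setP ab neuv.
have /eqP va : v == a.
  by have := ab v; rewrite !inE eqxx orbT [v == u]eq_sym (negPf neuv) orbF.
have /eqP ub : u == b.
  by have := ab u; rewrite !inE eqxx orbT (negPf neuv) orbF => <-.
by rewrite va ub.
Qed.

(* Without an edge, no curve through u is a curve through v. *)
Lemma kernel_sum_nonedge u v n p : ~~ E u v -> u != v ->
  chain_above (kernel_sum u v) n p -> n = 0%N.
Proof.
move=> nEuv neuv cp; have [pp J0 _] := cp.
have kv a : ev v a = 0 -> p 0%N a by move/(kernel_sumr u)/J0.
have pq : is_prime (fun f => p 0%N (diag f)) by apply: is_prime_preim.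
apply: (chain_above_max _ (contract_chain cp kv)).
(* The contracted prime contains a factor of t_v and a factor of t_u. Equal codes would make v a
   neighbour of u, so these are two different curves and the prime is maximal. *)
have /J0/(prime_prod pq)[b Eb Jb] := kernel_sum_vertex_curve neuv.
have nevu : v != u by rewrite eq_sym.
have /kernel_sumC/J0/(prime_prod pq)[a Ea Ja] := kernel_sum_vertex_curve nevu.
apply: (curves_coprime _ pq Ja Jb); apply/eqP => /edge_code_inj/(_ neuv)[ea eb].
by move: Ea nEuv; rewrite ea (negPf nevu) orbF => ->.
Qed.

End GluedRing.

(** * Noetherianity and completeness of the glued ring *)

(* The n-th power of the ideal (x, y). *)
Fixpoint pair_pow (R : comNzRingType) (x y : R) (n : nat) (a : R) : Prop :=
  if n is m.+1 then
    exists b c, [/\ pair_pow x y m b, pair_pow x y m c & a = x * b + y * c]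
  else True.

Section PairPow.
Variables (R : comNzRingType) (x y : R).

Lemma pair_pow_ideal n : is_ideal (pair_pow x y n).
Proof.
elim: n => [|n IH] //=; split.
- by exists 0, 0; split; try exact: (ideal_0 IH); rewrite !mulr0 addr0.
- move=> _ _ [b [c [Hb Hc ->]]] [b' [c' [Hb' Hc' ->]]].
  exists (b + b'), (c + c'); split; try exact: (ideal_D IH).
  by rewrite !mulrDr addrACA.
- move=> a _ [b [c [Hb Hc ->]]]; exists (a * b), (a * c).
  by split; try exact: (ideal_M IH); rewrite mulrDr !(mulrCA a).
Qed.

Lemma pair_powM m n a b : pair_pow x y m a -> pair_pow x y n b ->
  pair_pow x y (m + n) (a * b).
Proof.
elim: m a => [|m IH] a /=; first by move=> _; apply: (ideal_M (pair_pow_ideal n)).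
move=> [c [d [Hc Hd ->]]] Hb; exists (c * b), (d * b); split; try exact: IH.
by rewrite mulrDl !mulrA.
Qed.

Lemma pair_pow_in_ideal_pow (I : idealr R) n a : x \in I -> y \in I ->
  pair_pow x y n a -> in_ideal_pow I n a.
Proof.
move=> Ix Iy; elim: n a => [|n IH] a /=.
  move=> _; exists 1%N, (fun=> a), (fun _ _ => x); split=> [//|].
  by rewrite big_ord1 big_ord0 mulr1.
move=> [b [c [/IH[k [d [z [Iz ->]]]] /IH[k' [d' [z' [Iz' ->]]]] ->]]].
exists (k + k')%N, (fun i => match split i with inl i => d i | inr i => d' i end).
(* Index 0 carries the new factor, x or y according to the summand; the others carry the earlier
   factors, shifted by one. *)
exists (fun i j => match split i, unlift ord0 j with
  | inl i, Some j => z i j | inr i, Some j => z' i j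
  | inl _, None => x | inr _, None => y end).
split=> [i j|]; first by case: split => l; case: unlift.
rewrite big_split_ord !mulr_sumr; congr (_ + _); apply: eq_bigr => i _.
  rewrite -[lshift _ _]/(unsplit (inl i)) unsplitK big_ord_recl unlift_none mulrCA.
  by congr (_ * (_ * _)); apply: eq_bigr => j _; rewrite liftK.
rewrite -[rshift _ _]/(unsplit (inr i)) unsplitK big_ord_recl unlift_none mulrCA.
by congr (_ * (_ * _)); apply: eq_bigr => j _; rewrite liftK.
Qed.

(** A product of n * k factors is cut into n blocks of k, each of which lies in (x, y). *)
Lemma in_ideal_pow_pair_pow (I : idealr R) k n a :
  (forall z : 'I_k -> R, (forall j, z j \in I) -> pair_pow x y 1 (\prod_j z j)) ->
  in_ideal_pow I (n * k) a -> pair_pow x y n a.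
Proof.
move=> Ik [l [c [z [Iz ->]]]].
apply: (ideal_sum (pair_pow_ideal n)) => i; apply: (ideal_M (pair_pow_ideal n)).
move: (z i) (Iz i) => {c Iz}{}z; elim: n z => [|n IH] //.
rewrite mulSn => z Iz; rewrite big_split_ord -[n.+1]add1n; apply: pair_powM.
  by apply: Ik => j; apply: Iz.
by apply: IH => j; apply: Iz.
Qed.

End PairPow.

Lemma pair_pow_morph (R R' : comNzRingType) (phi : {rmorphism R -> R'}) x y n a :
  pair_pow x y n a -> pair_pow (phi x) (phi y) n (phi a).
Proof.
elim: n a => [|n IH] a //= [b [c [Hb Hc ->]]]; exists (phi b), (phi c).
by split; [apply: IH | apply: IH | rewrite rmorphD !rmorphM].
Qed.

Section TwoVariablesOrder.
Variable F : fieldType.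
Notation P := (series (series F)).

Lemma pair_pow_order n (f : P) :
  pair_pow (vX F) (vY F) n f <-> (forall i j, (i + j < n)%N -> f i j = 0).
Proof.
split.
  elim: n f => [|n IH] f //= [b [c [/IH b0 /IH c0 ->]]] i j ltn.
  rewrite !coef_seriesD /vX /vY !coef_monoM subn0 !mul1r.
  have -> : (if (0 < i)%N then b (i - 1)%N else 0) j = 0.
    case: posnP => // i0; apply: b0.
    by rewrite -(ltn_add2l 1) addnA subnKC.
  rewrite add0r; case: posnP => // j0; apply: c0.
  by rewrite -(ltn_add2l 1) addnCA subnKC.
elim: n f => [|n IH] f //= f0.
exists (shift 1 f), (mono 0 (shift 1 (f 0%N))); split.
- by apply: IH => i j ltn; apply: f0; rewrite add1n addSn ltnS.
- apply: IH => -[|i] j ltn //=; apply: f0.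
  by rewrite add0n add1n ltnS.
- by apply: max_ideal_gen; apply: f0.
Qed.

(** The terms [c m] with m > i + j have no coefficient at X^i Y^j, so each coefficient of the limit
    is a finite sum. *)
Lemma pair_pow_series (c : nat -> P) :
  (forall n, pair_pow (vX F) (vY F) n (c n)) ->
  exists C, forall n, pair_pow (vX F) (vY F) n (C - \sum_(m < n) c m).
Proof.
move=> cP; exists (Series (fun i => Series (fun j => \sum_(m < (i + j).+1) c m i j))).
move=> n; apply/pair_pow_order => i j ltn.
rewrite !coef_seriesB !coef_series_sum /=; apply/eqP; rewrite subr_eq0; apply/eqP.
rewrite -(subnKC ltn) big_split_ord /= [X in _ = _ + X]big1 ?addr0 // => m _.
by apply: (proj1 (pair_pow_order _ _) (cP _)); rewrite leq_addr.
Qed.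

End TwoVariablesOrder.

Section GluedRingTopology.
Variables (F : fieldType) (V : finType) (E : rel V) (v0 : V).
Notation P := (series (series F)).
Notation A := (glued_ring F E v0).
Notation diag := (@diag F V E v0).
Notation X := (diag (vX F)).
Notation Y := (diag (vY F)).

(** A sits inside the Noetherian P-module P^V. Only stability under P is asked of J: ideals of A
    will give Noetherianity, and J = A the finite generators used for completeness. *)
Lemma glued_fin_gen (J : A -> Prop) :
  J 0 -> (forall a b, J a -> J b -> J (a + b)) -> (forall f a, J a -> J (diag f * a)) ->
  exists (n : nat) (g : 'I_n -> A), (forall i, J (g i)) /\
    forall a, J a -> exists c : 'I_n -> P, a = \sum_i diag (c i) * g i.
Proof.
move=> J0 JD JM.
have [|s [sJ sg]] := @ffun_noetherian P V
    (series_noetherian (series_noetherian (@field_noetherian F)))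
    (fun b => exists2 a : A, J a & glued_val a = b).
  split; first by exists 0.
    by move=> _ _ [a Ja <-] [b Jb <-]; exists (a + b) => //; apply: JD.
  move=> f _ [a Ja <-]; exists (diag f * a); first exact: JM.
  by apply/ffunP => v; rewrite !ffunE.
have /choice[g gE] : forall i : 'I_(size s), exists a : A, J a /\ glued_val a = s`_i.
  by move=> i; have [a Ja aE] := sJ _ (mem_nth 0 (ltn_ord i)); exists a.
exists (size s), g; split=> [i|a Ja]; first by case: (gE i).
have [|c aE] := @spanP _ _ s (glued_val a); first by apply: sg; exists a.
exists c; apply: val_inj; rewrite [LHS]aE (raddf_sum val); apply: eq_bigr => i _ /=.
by rewrite -(proj2 (gE i)); apply/ffunP => v; rewrite !ffunE.
Qed.

Lemma glued_noetherian : noetherian_ring A.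
Proof.
move=> I; have [||f a|n [g [gI gE]]] := @glued_fin_gen (fun a => a \in I).
- exact: rpred0.
- exact: rpredD.
- exact: idealMr.
exists n, g => a; split=> [/gE[c ->]|[c ->]]; first by exists (diag \o c).
by apply: rpred_sum => i _; apply: idealMr.
Qed.

(** With d_j the constant family on the j-th coordinate of z_j, the product of the z_j - d_j
    vanishes, each coordinate being killed by its own factor. Since all d_j lie in (X, Y)A, the
    product of the z_j is congruent to it modulo (X, Y)A. *)
Lemma glued_max_prod (z : 'I_#|V| -> A) : (forall j, glued_max (z j)) ->
  pair_pow X Y 1 (\prod_j z j).
Proof.
move=> mz; pose d j := diag (ev (enum_val j) (z j)).
have dP j : pair_pow X Y 1 (d j).
  apply: pair_pow_morph; apply/pair_pow_order => -[|i] [|k] // _.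
  exact: mz.
have zd0 : \prod_j (z j - d j) = 0.
  apply: ev_inj => v; rewrite rmorph_prod ev0 (bigD1 (enum_rank v)) //=.
  by rewrite evB /d enum_rankK ev_diag subrr mul0r.
rewrite -[\prod_j z j]subr0 -zd0; apply: (ideal_prod_congr (pair_pow_ideal X Y 1)) => j.
by rewrite subKr.
Qed.

Section Complete.
Variables (m : idealr A) (mE : forall a, a \in m <-> glued_max a).

Lemma glued_pow_pair n a : in_ideal_pow m (n * #|V|) a -> pair_pow X Y n a.
Proof.
apply: in_ideal_pow_pair_pow => z mz; apply: glued_max_prod => j.
exact/mE/mz.
Qed.

Lemma pair_glued_pow n a : pair_pow X Y n a -> in_ideal_pow m n a.
Proof.
by apply: pair_pow_in_ideal_pow; apply/mE => v; rewrite ev_diag.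
Qed.

Lemma glued_separated a : (forall n, in_ideal_pow m n a) -> a = 0.
Proof.
move=> ma; apply: ev_inj => v; rewrite ev0; apply: seriesP => i; apply: seriesP => j.
have : pair_pow (ev v X) (ev v Y) (i + j).+1 (ev v a).
  exact: (pair_pow_morph (ev v) (glued_pow_pair (ma _))).
by rewrite !ev_diag => /pair_pow_order; apply.
Qed.

(** Along a fast subsequence the successive differences lie in growing powers of (X, Y)A; their
    coefficients on finitely many P-generators of A lie in the same powers of (X, Y), and are summed
    in P. *)
Lemma glued_adic_complete : adic_complete m.
Proof.
split; first exact: glued_separated.
move=> u uC.
have [//|//|//|r [g [_ gE]]] := @glued_fin_gen (fun=> True).
have gEn n a : pair_pow X Y n a -> exists c : 'I_r -> P,
    (forall l, pair_pow (vX F) (vY F) n (c l)) /\ a = \sum_l diag (c l) * g l.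
  elim: n a => [|n IH] a /=; first by move=> _; have [c ->] := gE a I; exists c.
  move=> [_ [_ [/IH[b [bn ->]] /IH[c [cn ->]] ->]]].
  exists (fun l => vX F * b l + vY F * c l); split=> [l|]; first by exists (b l), (c l).
  rewrite !mulr_sumr -big_split /=; apply: eq_bigr => l _.
  by rewrite rmorphD !rmorphM /= mulrDl !mulrA.
have /choice[N NP] : forall n, exists N, forall i j : nat, (N <= i)%N -> (N <= j)%N ->
    pair_pow X Y n (u i - u j).
  move=> n; have [N NP] := uC (n * #|V|)%N; exists N => i j Ni Nj.
  by apply: glued_pow_pair; apply: NP.
(* Summing the moduli yields a monotone one that dominates each [N n]. *)
pose M n := (\sum_(k < n.+1) N k)%N.
have leNM n : (N n <= M n)%N by rewrite /M big_ord_recr leq_addl.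
have leMM n : (M n <= M n.+1)%N by rewrite /M [leqRHS]big_ord_recr leq_addr.
pose w n := u (M n).
have /choice[c cP] : forall n, exists c : 'I_r -> P,
    (forall l, pair_pow (vX F) (vY F) n (c l)) /\
    w n.+1 - w n = \sum_l diag (c l) * g l.
  by move=> n; apply: gEn; apply: NP; rewrite ?leNM // (leq_trans (leNM n)) ?leMM.
have /choice[C CP] : forall l, exists C, forall n,
    pair_pow (vX F) (vY F) n (C - \sum_(k < n) c k l).
  by move=> l; apply: (pair_pow_series (c := fun k => c k l)) => n; apply: (proj1 (cP n)).
exists (w 0%N + \sum_l diag (C l) * g l) => n; exists (M n) => i leMi.
apply: pair_glued_pow.
rewrite -(subrK (w n) (u i)) -addrA; apply: (ideal_D (pair_pow_ideal X Y n)).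
  by apply: NP; rewrite ?leNM // (leq_trans (leNM n)).
have -> : w n = w 0%N + \sum_l diag (\sum_(k < n) c k l) * g l.
  elim: n {leMi} => [|n IH].
    by rewrite big1 ?addr0 // => l _; rewrite big_ord0 rmorph0 mul0r.
  rewrite -(subrK (w n) (w n.+1)) (proj2 (cP n)) IH addrCA; congr (_ + _).
  rewrite addrC -big_split /=; apply: eq_bigr => l _.
  by rewrite big_ord_recr rmorphD mulrDl.
rewrite opprD addrACA subrr add0r -sumrB.
apply: (ideal_sum (pair_pow_ideal X Y n)) => l; rewrite -mulrBl -rmorphB /=.
apply: (ideal_Mr (pair_pow_ideal X Y n)); apply: pair_pow_morph.
by rewrite -opprB; apply: (ideal_N (pair_pow_ideal _ _ n)).
Qed.

End Complete.

Lemma glued_local (m : idealr A) : (forall a, a \in m <-> glued_max a) ->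
  is_local_ring m.
Proof.
move=> mE.
have sub_m (J : idealr A) : {subset J <= m}.
  move=> a Ja; apply/mE; apply: contrapT => /glued_unit[b ab1].
  by have := idealMr b Ja; rewrite mulrC ab1 idealr1.
split=> [J mJ|J maxJ] a; apply/idP/idP => [|].
- exact: sub_m.
- exact: mJ.
- exact: sub_m.
- by rewrite (maxJ m (@sub_m J)).
Qed.

End GluedRingTopology.

(** * The Hochster-Huneke graph *)

Section HochsterHuneke.
Variables (F : fieldType) (V : finType) (E : rel V) (v0 : V).
Hypotheses (E_sym : symmetric E) (E_irrefl : irreflexive E).
Notation A := (glued_ring F E v0).

Variable k : V -> prime_idealr A.
Hypothesis kE : forall v a, a \in k v <-> ev v a = 0.

(** A prime inside [k v] contains some kernel, and the kernels are pairwise incomparable. *)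
Lemma kernel_minimal v : minimal_prime (k v).
Proof.
move=> q qk; have [w kw] := prime_contains_kernel (prime_idealr_is_prime q).
have wv : w = v by apply: (kernel_incomparable E_sym (v0 := v0)) => a /kw/qk/kE.
by move=> a; apply/idP/idP => [/qk//|/kE]; rewrite -wv => /kw.
Qed.

Lemma minimal_is_kernel (q : prime_idealr A) : minimal_prime q ->
  exists v, k v =i q.
Proof.
move=> minq; have [v kv] := prime_contains_kernel (prime_idealr_is_prime q).
by exists v; apply: minq => a /kE/kv.
Qed.

Lemma glued_equidimensional : equidimensional A 2.
Proof.
move=> q /minimal_is_kernel[v vq].
by apply: (krull_dim_ideal_quot _ (kernel_dim F E v0 v)) => a; rewrite -vq.
Qed.

Lemma edge_dim u v : E u v <->
  u <> v /\ exists e : nat, e.+1 = 2 /\ quot_sum_has_dim (k u) (k v) e.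
Proof.
split=> [Euv|[/eqP neuv [e [[->] [K [KE]]]]]].
  have neuv : u != v by apply: contraTneq Euv => ->; rewrite E_irrefl.
  split; first exact/eqP.
  have [K KE] := ex_idealr (kernel_sum_ideal F E v0 u v)
    (@kernel_sum_proper F V E E_sym v0 u v).
  exists 1%N; split=> //; exists K; split=> [a|]; last first.
    exact: (krull_dim_ideal_quot KE (kernel_sum_dim F E_sym v0 Euv neuv)).
  by rewrite KE; split=> -[x [y [? ? ?]]]; exists x, y; split=> //; apply/kE.
(* A quotient of dimension 1 would give a chain of length 1 above the sum, but without an edge such
   chains have length 0. *)
move=> /quot_dim_chain[p pK]; apply/negPn/negP => nEuv.
have pS : chain_above (kernel_sum u v) 1 p.
  case: pK => pp J0 pS; split=> // a [x [y [? ? ?]]]; apply: J0; apply/KE.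
  by exists x, y; split=> //; apply/kE.
by have := kernel_sum_nonedge E_sym nEuv neuv pS.
Qed.

End HochsterHuneke.

Local Close Scope ring_scope.

Theorem mainTheorem4 (V : finType) (E : rel V) (E_sym : symmetric E)
    (E_irrefl : irreflexive E) (V_ge2 : 2 <= #|V|) :
  exists (A : comNzRingType) (m : idealr A) (d : nat),
    is_local_ring m /\ noetherian_ring A /\ adic_complete m /\
    has_krull_dim A d /\ equidimensional A d /\
    is_hochster_huneke_graph A d E.
Proof.
have /card_gt0P[v0 _] : (0 < #|V|)%N by apply: leq_trans V_ge2.
(* Any coefficient field serves. *)
pose A := glued_ring rat E v0.
have [m mE] := ex_idealr (prime_ideal (glued_max_prime rat E v0))
  (prime_proper (glued_max_prime rat E v0)).
have /choice[k kE] := fun v => ex_prime_idealr (kernel_prime rat E v0 v).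
exists A, m, 2%N.
split; first exact: glued_local.
split; first exact: glued_noetherian.
split; first exact: glued_adic_complete.
split; first exact: krull_dim_ring (glued_dim rat E v0).
split; first exact: (glued_equidimensional kE).
exists #|V|, (fun i => k (enum_val i)), enum_rank; split.
- split=> [i|i j ij|q minq].
  + exact: (kernel_minimal E_sym kE).
  + apply: enum_val_inj; apply: (kernel_incomparable E_sym (v0 := v0)) => a.
    by move=> /kE; rewrite ij => /kE.
  + have [v vq] := minimal_is_kernel kE minq.
    by exists (enum_rank v); rewrite enum_rankK.
- exact: enum_rank_bij.
move=> u v; rewrite /hochster_huneke_edge !enum_rankK.
rewrite (edge_dim E_sym E_irrefl kE u v); split=> -[neuv H]; split=> //.
  by move/enum_rank_inj.
by move=> uv; apply: neuv; rewrite uv.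
Qed.
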